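(* For all $p, q\in (1,\infty)$, $$\int_0^\infty \frac{\sin_{p,q}{x}}{x}\,dx =\frac{\pi}{2} \int_0^1 \frac{\sin_{p,q}{(\pi_{p,q}x)}}{\sin{(\pi x)}}\,dx,$$ $$\int_0^\infty \left(\frac{\sin_{p,q}{x}}{x}\right)^2\,dx =\frac{\pi^2}{2\pi_{p,q}} \int_0^1 \left[\frac{\sin_{p,q}{(\pi_{p,q}x)}}{\sin{(\pi x)}}\right]^2\,dx.$$ In particular, when $p=q=2$, $$\int_0^\infty \frac{\sin{x}}{x}\,dx=\frac{\pi}{2} =\int_0^\infty \left(\frac{\sin{x}}{x}\right)^2\,dx.$$
   Context: For $p,q\in(1,\infty)$ let $F_{p,q}(x)=\int_0^x (1-t^q)^{-1/p}\,dt$ for $x\in[0,1]$, and let $\pi_{p,q}:=2F_{p,q}(1)$ (equivalently $\pi_{p,q}/2=B(1/p^*,1/q)/q$, where $B$ is the beta function and $p^*=p/(p-1)$). The generalised sine function $\sin_{p,q}:[0,\pi_{p,q}/2]\to[0,1]$ is the inverse of $F_{p,q}:[0,1]\to[0,\pi_{p,q}/2]$. It is extended to all of $\mathbb{R}$ as a $2\pi_{p,q}$-periodic function by $\sin_{p,q}x=\sin_{p,q}(\pi_{p,q}-x)$ and $\sin_{p,q}(-x)=-\sin_{p,q}x$. For $p=q=2$ this is the usual sine and $\pi_{2,2}=\pi$. The function $(\sin_{p,q}x)/x$ is given the value $1$ at $x=0$. Integrals over $[0,\infty)$ are improper Riemann integrals, i.e. $\int_0^\infty=\lim_{R\to\infty}\int_0^R$.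 *)

(* Defs.v *)
From Stdlib Require Import Reals.
From Coquelicot Require Import Coquelicot.
Open Scope R_scope.

(* [Rpower 0 a] is [1] in the standard library; here [0 ^ a = 0], as wanted
   for [a > 0].  The value of [0 ^ a] for [a < 0] only occurs at the
   singular endpoint of [F_pq] below, where it does not affect the integral. *)
Definition rpow (x a : R) : R :=
  if Rlt_dec 0 x then Rpower x a else 0.

Definition F_integrand (p q t : R) : R :=
  rpow (1 - rpow t q) (- (1 / p)).

(* The integrand is unbounded near [1], so [F_pq p q 1] is improper. *)
Definition F_pq (p q x : R) : R :=
  if Rlt_dec x 1 then RInt (F_integrand p q) 0 x
  else RInt_gen (F_integrand p q) (at_point 0) (at_left 1).

Definition pi_pq (p q : R) : R := 2 * F_pq p q 1.

(* Inverse of [F_pq p q : [0,1] -> [0, pi_pq p q / 2]]; [iota] is Coquelicot's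
   definite description operator. *)
Definition F_pq_inv (p q y : R) : R :=
  iota (fun x : R => 0 <= x <= 1 /\ F_pq p q x = y).

(* Values on [[0, pi_pq p q]], by reflection in [pi_pq p q / 2]. *)
Definition sin_pq_half_period (p q x : R) : R :=
  if Rle_dec x (pi_pq p q / 2) then F_pq_inv p q x
  else F_pq_inv p q (pi_pq p q - x).

(* The translate of [x] by a multiple of [2 * pi_pq p q] that lies in
   [[- pi_pq p q, pi_pq p q)]; [Int_part] is the floor function. *)
Definition reduce_pq (p q x : R) : R :=
  x - IZR (Int_part ((x + pi_pq p q) / (2 * pi_pq p q))) * (2 * pi_pq p q).

Definition sin_pq (p q x : R) : R :=
  let r := reduce_pq p q x in
  if Rle_dec 0 r then sin_pq_half_period p q r
  else - sin_pq_half_period p q (- r).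

(* [f x / x], given the value [1] at [x = 0]. *)
Definition over_id (f : R -> R) (x : R) : R :=
  if Req_dec_T x 0 then 1 else f x / x.

(* [int_0^oo f = l] as a convergent improper Riemann integral. *)
Definition is_RInt_0_infty (f : R -> R) (l : R) : Prop :=
  is_RInt_gen f (at_point 0) (Rbar_locally p_infty) l.

(* Main.v *)
Require Import Defs.
From Stdlib Require Import Reals Ranalysis5 Lra Lia FunctionalExtensionality.
From Coquelicot Require Import Coquelicot.
Open Scope R_scope.

(** Cut the half-line into intervals of length [P = pi_pq p q] and fold them all onto
    [[0, P]].  The generalised sine [f] satisfies [f (x + P) = - f x] and
    [f (P - x) = f x], so folding each interval once by translation and once by
    reflection shows that twice the integral of [f y / y] up to [K P] is the integral
    over [[0, P]] of

      [f x * sum_{- K <= n < K} (-1)^n / (x + n P)]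

    (lemmas [is_RInt_pair_sum] and [sine_like_pair_sum]).  By the partial fraction
    expansion of the cosecant this sum tends to [(PI / P) / sin (PI x / P)], and
    rescaling [[0, P]] to [[0, 1]] gives the first formula.  For the square the signs
    disappear and the expansion of the squared cosecant takes over.

    The limit may be taken under the integral because the expansions hold with an
    error at most [/ 2 ^ k], uniformly in [x], when [K = 2 ^ k]
    ([csc_partial_fractions], [csc_sqr_partial_fractions]).  Both come from exact
    finite identities: iterating the duplication formula for the cotangent writes
    [/ sin x] as [/ 2 ^ (k + 1)] times an alternating sum of cotangents of the
    arguments [(x + n PI) / 2 ^ (k + 1)] ([dyadic_pair_sum]); these all lie within
    [PI / 2] of 0, where [/ y - cot y] is bounded and monotone, so that its alternating
    sums are bounded too.  The squared cosecant is similar.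

    To pass from the endpoints [2 ^ k P] to arbitrary ones it suffices that the
    integral over [[a, b]] is at most a constant over [a]
    ([is_RInt_0_infty_subsequence]).  For the square this is clear as [f] is bounded;
    for [f x / x] integrate by parts, the primitive of [f] being bounded by
    antiperiodicity ([sine_like_over_id_tail]).

    The argument uses only the properties collected in [sine_like], which the
    ordinary sine has too; for it the integrals over [[0, 1]] have integrand 1, whence
    the classical values.  For the generalised sine everything follows from the
    inequality [y - x <= F_pq p q y - F_pq p q x], which makes the inverse
    1-Lipschitz ([F_pq_expanding]), and from the derivative of [F_pq] at 0. *)

(** * Finite sums *)

Fixpoint sum_lt (f : nat -> R) (N : nat) : R :=
  match N with O => 0 | S n => sum_lt f n + f n end.

Lemma sum_lt_ext f g N :
  (forall n, (n < N)%nat -> f n = g n) -> sum_lt f N = sum_lt g N.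
Proof.
  induction N as [|N IH]; intros H; simpl; [easy|].
  rewrite IH by (intros; apply H; lia). now rewrite H by lia.
Qed.

Lemma sum_lt_plus f g N :
  sum_lt (fun n => f n + g n) N = sum_lt f N + sum_lt g N.
Proof. induction N as [|N IH]; simpl; [|rewrite IH]; ring. Qed.

Lemma sum_lt_scal c f N : sum_lt (fun n => c * f n) N = c * sum_lt f N.
Proof. induction N as [|N IH]; simpl; [|rewrite IH]; ring. Qed.

Lemma sum_lt_cat f M N :
  sum_lt f (M + N) = sum_lt f M + sum_lt (fun n => f (M + n)%nat) N.
Proof.
  induction N as [|N IH]; simpl.
  - rewrite Nat.add_0_r; ring.
  - rewrite Nat.add_succ_r; simpl; rewrite IH; ring.
Qed.

Lemma sum_lt_rev f N : sum_lt f N = sum_lt (fun n => f (N - 1 - n)%nat) N.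
Proof.
  revert f; induction N as [|N IH]; intros f; [easy|].
  change (S N) with (1 + N)%nat at 1.
  rewrite sum_lt_cat, IH; simpl.
  replace (N - 0 - N)%nat with 0%nat by lia.
  rewrite (sum_lt_ext (fun n => f (S (N - 1 - n))) (fun n => f (N - 0 - n)%nat)).
  - ring.
  - intros n Hn; f_equal; lia.
Qed.

(** Matches each index of the lower half with its mirror image in the upper
    half: this is how the terms of the dyadic identities below recombine. *)
Lemma sum_lt_fold f K :
  sum_lt f (2 * K) = sum_lt (fun n => f n + f (2 * K - 1 - n)%nat) K.
Proof.
  replace (2 * K)%nat with (K + K)%nat by lia.
  rewrite sum_lt_cat, sum_lt_plus; f_equal.
  rewrite sum_lt_rev; apply sum_lt_ext; intros n Hn; f_equal; lia.
Qed.

Lemma sum_lt_abs_le f N B :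
  (forall n, (n < N)%nat -> Rabs (f n) <= B) -> Rabs (sum_lt f N) <= INR N * B.
Proof.
  induction N as [|N IH]; intros H.
  - simpl; rewrite Rabs_R0; lra.
  - rewrite S_INR; simpl.
    eapply Rle_trans; [apply Rabs_triang|].
    assert (Rabs (f N) <= B) by (apply H; lia).
    assert (Rabs (sum_lt f N) <= INR N * B) by (apply IH; intros; apply H; lia).
    lra.
Qed.

Lemma pow_m1_sqr n : (-1) ^ n * (-1) ^ n = 1.
Proof. rewrite <- Rpow_mult_distr; replace (-1 * -1) with 1 by ring; apply pow1. Qed.

(** For nondecreasing nonnegative terms the last one dominates: the partial sum,
    multiplied by the sign of its last term, lies between 0 and that term. *)
Lemma alternating_sum_le b N B :
  (forall n, (n < N)%nat -> 0 <= b n <= B) ->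
  (forall n, (S n < N)%nat -> b n <= b (S n)) ->
  0 <= B -> Rabs (sum_lt (fun n => (-1) ^ n * b n) N) <= B.
Proof.
  intros Hb Hm HB.
  destruct N as [|N]; [simpl; rewrite Rabs_R0; lra|].
  assert (H : 0 <= (-1) ^ N * sum_lt (fun n => (-1) ^ n * b n) (S N) <= b N).
  { induction N as [|N IH].
    - simpl; assert (0 <= b 0%nat <= B) by (apply Hb; lia); lra.
    - destruct IH as [I1 I2]; [intros; apply Hb; lia | intros; apply Hm; lia |].
      set (s := sum_lt _ (S N)) in *.
      change (sum_lt _ (S (S N))) with (s + (-1) ^ (S N) * b (S N)).
      rewrite Rmult_plus_distr_l, <- Rmult_assoc, pow_m1_sqr.
      assert (b N <= b (S N)) by (apply Hm; lia).
      simpl; lra. }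
  assert (HN : b N <= B) by (apply Hb; lia).
  set (s := sum_lt _ (S N)) in *.
  replace (Rabs s) with (Rabs ((-1) ^ N * s)).
  - rewrite Rabs_pos_eq; lra.
  - rewrite Rabs_mult, <- RPow_abs, Rabs_m1, pow1; ring.
Qed.

(** * Partial fractions of the cosecant and of its square *)

(** The terms of index [n] and [- n - 1] of the bilateral series
    [sum s^n phi (x + n d)] are grouped together, the second one being written
    with the argument [(n + 1) d - x], so that for [0 < x < d] all arguments are
    positive.  For [s = -1] and an odd [phi], or [s = 1] and an even [phi], this
    is the symmetric partial sum over [- K <= n < K]. *)
Definition pair_sum (s : R) (phi : R -> R) (d x : R) (K : nat) : R :=
  sum_lt (fun n => s ^ n * (phi (x + INR n * d) + phi ((INR n + 1) * d - x))) K.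

Lemma pair_sum_args_range d x K n :
  0 < x < d -> (n < K)%nat ->
  0 < x + INR n * d < INR K * d /\ 0 < (INR n + 1) * d - x < INR K * d.
Proof.
  intros Hx Hn.
  assert (0 <= INR n) by apply pos_INR.
  assert (INR n + 1 <= INR K) by (rewrite <- S_INR; apply le_INR; lia).
  split; split; nra.
Qed.

(** The duplication formula sends the argument [y] to [y / 2] and [PI / 2 - y / 2].
    Since [2 K d = PI], halving the mesh sends the two arguments of index [n] to
    one argument of index [n] and one of index [2 K - 1 - n], whose sign
    [s^(2 K - 1 - n)] is [s^n s]. *)
Lemma pair_sum_halve phi s lam d x K :
  s * s = 1 ->
  (forall y, 0 < y < PI -> phi y = lam * (phi (y / 2) + s * phi (PI / 2 - y / 2))) ->
  (0 < K)%nat -> 2 * INR K * d = PI -> 0 < x < d ->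
  pair_sum s phi d x K = lam * pair_sum s phi (d / 2) (x / 2) (2 * K).
Proof.
  intros Hs Hphi HK Hd Hx.
  unfold pair_sum; rewrite sum_lt_fold, <- sum_lt_scal.
  apply sum_lt_ext; intros n Hn.
  destruct (pair_sum_args_range d x K n Hx Hn) as [H1 H2].
  rewrite (Hphi (x + _)), (Hphi ((INR n + 1) * d - x)) by (pose proof PI_RGT_0; lra).
  assert (Hn' : INR (2 * K - 1 - n) = 2 * INR K - 1 - INR n).
  { rewrite !minus_INR, mult_INR by lia; simpl; ring. }
  assert (Hsn : s ^ (2 * K - 1 - n) = s ^ n * s).
  { assert (E : s ^ (2 * K - 1 - n) * (s ^ n * s) = 1).
    { replace (s ^ n * s) with (s ^ (S n)) by (simpl; ring).
      rewrite <- pow_add; replace (2 * K - 1 - n + S n)%nat with (2 * K)%nat by lia.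
      rewrite pow_mult; replace (s ^ 2) with 1 by (simpl; lra); apply pow1. }
    assert (E2 : (s ^ n * s) * (s ^ n * s) = 1).
    { replace ((s ^ n * s) * (s ^ n * s)) with ((s * s) ^ n * (s * s))
        by (rewrite Rpow_mult_distr; ring).
      rewrite Hs, pow1; ring. }
    transitivity (s ^ (2 * K - 1 - n) * ((s ^ n * s) * (s ^ n * s))).
    - rewrite E2; ring.
    - rewrite <- Rmult_assoc, E; ring. }
  rewrite Hsn, Hn', <- Hd.
  replace ((x + INR n * d) / 2) with (x / 2 + INR n * (d / 2)) by field.
  replace (((INR n + 1) * d - x) / 2) with ((INR n + 1) * (d / 2) - x / 2) by field.
  replace (2 * INR K * d / 2 - (x / 2 + INR n * (d / 2)))
    with ((2 * INR K - 1 - INR n + 1) * (d / 2) - x / 2) by field.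
  replace (2 * INR K * d / 2 - ((INR n + 1) * (d / 2) - x / 2))
    with (x / 2 + (2 * INR K - 1 - INR n) * (d / 2)) by field.
  ring.
Qed.

Lemma INR_pow2 k : INR (2 ^ k) = 2 ^ k.
Proof. rewrite pow_INR; reflexivity. Qed.

(** An exact finite partial fraction expansion, obtained by iterating the
    duplication formula of [phi]; the series expansions below come from it by
    replacing [phi] by its principal part at 0. *)
Lemma dyadic_pair_sum phi D s lam k x :
  s * s = 1 ->
  (forall y, 0 < y < PI -> phi y = lam * (phi (y / 2) + s * phi (PI / 2 - y / 2))) ->
  (forall y, 0 < y < PI -> D y = lam * (phi (y / 2) + phi (PI / 2 - y / 2))) ->
  0 < x < PI ->
  D x = lam ^ (S k) * pair_sum s phi (PI / 2 ^ S k) (x / 2 ^ S k) (2 ^ k).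
Proof.
  intros Hs Hphi HD Hx; induction k as [|k IH].
  - rewrite (HD x Hx); unfold pair_sum; simpl.
    replace (x / (2 * 1) + 0 * (PI / (2 * 1))) with (x / 2) by field.
    replace ((0 + 1) * (PI / (2 * 1)) - x / (2 * 1)) with (PI / 2 - x / 2) by field.
    ring.
  - assert (H2 : 0 < 2 ^ S k) by (apply pow_lt; lra).
    rewrite IH, (pair_sum_halve phi s lam); try assumption.
    + change (2 ^ S k)%nat with (2 * 2 ^ k)%nat.
      replace (PI / 2 ^ S k / 2) with (PI / 2 ^ S (S k))
        by (change (2 ^ S (S k)) with (2 * 2 ^ S k); field; lra).
      replace (x / 2 ^ S k / 2) with (x / 2 ^ S (S k))
        by (change (2 ^ S (S k)) with (2 * 2 ^ S k); field; lra).
      change (lam ^ S (S k)) with (lam * lam ^ S k); ring.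
    + pose proof (Nat.pow_nonzero 2 k); lia.
    + rewrite INR_pow2; change (2 ^ S k) with (2 * 2 ^ k).
      field. apply pow_nonzero; lra.
    + split.
      * apply Rdiv_lt_0_compat; lra.
      * apply Rmult_lt_compat_r; [apply Rinv_0_lt_compat|]; lra.
Qed.

Definition cot (y : R) : R := cos y / sin y.

Lemma sin_half_double y : sin y = 2 * sin (y / 2) * cos (y / 2).
Proof. rewrite <- sin_2a; f_equal; field. Qed.

Lemma cos_half_double y : cos y = cos (y / 2) * cos (y / 2) - sin (y / 2) * sin (y / 2).
Proof. rewrite <- cos_2a; f_equal; field. Qed.

Lemma sin_cos_half_pos y : 0 < y < PI -> 0 < sin (y / 2) /\ 0 < cos (y / 2).
Proof.
  intros Hy; split; [apply sin_gt_0 | apply cos_gt_0]; lra.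
Qed.

Lemma cot_halve y : 0 < y < PI ->
  cot y = / 2 * (cot (y / 2) + (-1) * cot (PI / 2 - y / 2)).
Proof.
  intros Hy; destruct (sin_cos_half_pos y Hy); unfold cot.
  rewrite cos_shift, sin_shift, (sin_half_double y), (cos_half_double y).
  field; lra.
Qed.

Lemma csc_halve y : 0 < y < PI ->
  / sin y = / 2 * (cot (y / 2) + cot (PI / 2 - y / 2)).
Proof.
  intros Hy; destruct (sin_cos_half_pos y Hy); unfold cot.
  rewrite cos_shift, sin_shift, (sin_half_double y).
  pose proof (sin2_cos2 (y / 2)) as E; unfold Rsqr in E.
  transitivity ((sin (y / 2) * sin (y / 2) + cos (y / 2) * cos (y / 2)) *
                / (2 * sin (y / 2) * cos (y / 2))).
  - rewrite E; ring.
  - field; lra.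
Qed.

Lemma csc_sqr_halve y : 0 < y < PI ->
  (/ sin y) ^ 2 = / 4 * ((/ sin (y / 2)) ^ 2 + (/ sin (PI / 2 - y / 2)) ^ 2).
Proof.
  intros Hy; destruct (sin_cos_half_pos y Hy).
  rewrite sin_shift, (sin_half_double y).
  pose proof (sin2_cos2 (y / 2)) as E; unfold Rsqr in E.
  replace ((/ sin (y / 2)) ^ 2 + (/ cos (y / 2)) ^ 2)
    with ((sin (y / 2) * sin (y / 2) + cos (y / 2) * cos (y / 2)) *
            ((/ sin (y / 2)) ^ 2 * (/ cos (y / 2)) ^ 2)) by (field; lra).
  rewrite E; field; lra.
Qed.

Lemma y_cos_le_sin y : 0 <= y <= PI / 2 -> y * cos y <= sin y.
Proof.
  intros Hy.
  destruct (Req_dec y 0) as [->|Hy0]; [rewrite sin_0; lra|].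
  destruct (MVT_gen (fun t => sin t - t * cos t) 0 y (fun t => t * sin t)) as [c [Hc E]].
  - intros t _; auto_derive; [easy|ring].
  - intros t _; apply derivable_continuous_pt.
    apply ex_derive_Reals_0; auto_derive; easy.
  - rewrite Rmin_left, Rmax_right in Hc by lra.
    rewrite sin_0 in E.
    assert (0 <= sin c) by (apply sin_ge_0; lra).
    assert (0 <= c * sin c) by (apply Rmult_le_pos; lra).
    assert (0 <= c * sin c * (y - 0)) by (apply Rmult_le_pos; lra).
    lra.
Qed.

Lemma cot_le_inv y : 0 < y <= PI / 2 -> 0 <= cot y <= / y.
Proof.
  intros Hy; unfold cot.
  assert (0 < sin y) by (apply sin_gt_0; lra).
  assert (0 <= cos y) by (apply cos_ge_0; lra).
  split.
  - apply Rmult_le_pos; [|left; apply Rinv_0_lt_compat]; lra.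
  - apply (Rmult_le_reg_l (y * sin y)); [nra|].
    replace (y * sin y * (cos y / sin y)) with (y * cos y) by (field; lra).
    replace (y * sin y * / y) with (sin y) by (field; lra).
    apply y_cos_le_sin; lra.
Qed.

(** The derivative of [/ t - cot t] is [/ sin t ^ 2 - / t ^ 2], which is
    nonnegative because [sin t <= t]. *)
Lemma inv_minus_cot_incr a b :
  0 < a -> a <= b -> b <= PI / 2 -> / a - cot a <= / b - cot b.
Proof.
  intros Ha Hab Hb.
  destruct (Req_dec a b) as [->|Hne]; [lra|].
  destruct (MVT_gen (fun t => / t - cot t) a b (fun t => / (sin t) ^ 2 - / t ^ 2))
    as [c [Hc E]]; rewrite ?Rmin_left, ?Rmax_right in * by lra.
  - intros t Ht; unfold cot.
    assert (0 < sin t) by (apply sin_gt_0; lra).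
    auto_derive; [repeat split; lra|].
    pose proof (sin2_cos2 t) as E; unfold Rsqr in E.
    transitivity ((sin t * sin t + cos t * cos t) / sin t ^ 2 - / t ^ 2).
    + field; lra.
    + rewrite E; field; lra.
  - intros t Ht; unfold cot.
    assert (0 < sin t) by (apply sin_gt_0; lra).
    apply derivable_continuous_pt, ex_derive_Reals_0.
    auto_derive; repeat split; lra.
  - assert (0 < sin c) by (apply sin_gt_0; lra).
    assert (sin c < c) by (apply sin_lt_x; lra).
    assert (/ c ^ 2 <= / sin c ^ 2).
    { apply Rinv_le_contravar; [apply pow_lt; lra|apply pow_incr; lra]. }
    assert (0 <= (/ sin c ^ 2 - / c ^ 2) * (b - a)) by (apply Rmult_le_pos; lra).
    lra.
Qed.

Lemma inv_minus_cot_bound y : 0 < y <= PI / 2 -> 0 <= / y - cot y <= 1.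
Proof.
  intros Hy.
  destruct (cot_le_inv y Hy).
  pose proof (inv_minus_cot_incr y (PI / 2) ltac:(lra) ltac:(lra) ltac:(lra)) as H1.
  assert (E : cot (PI / 2) = 0) by (unfold cot; rewrite cos_PI2; lra).
  rewrite E in H1.
  assert (1 <= PI / 2) by (pose proof PI2_1; lra).
  assert (/ (PI / 2) <= / 1) by (apply Rinv_le_contravar; lra).
  rewrite Rinv_1 in *; lra.
Qed.

(** Since [(/ sin y) ^ 2 = 1 + cot y ^ 2], the bounds [sin y <= y] and
    [cot y <= / y] give [(/ y) ^ 2 <= (/ sin y) ^ 2 <= 1 + (/ y) ^ 2]. *)
Lemma csc_sqr_minus_inv_sqr_bound y :
  0 < y <= PI / 2 -> Rabs ((/ y) ^ 2 - (/ sin y) ^ 2) <= 1.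
Proof.
  intros Hy.
  destruct (cot_le_inv y Hy) as [C1 C2].
  assert (Hs : 0 < sin y) by (apply sin_gt_0; lra).
  assert (H : sin y < y) by (apply sin_lt_x; lra).
  assert (/ y <= / sin y) by (apply Rinv_le_contravar; lra).
  assert (0 < / y) by (apply Rinv_0_lt_compat; lra).
  assert (E : (/ sin y) ^ 2 = 1 + cot y ^ 2).
  { unfold cot; pose proof (sin2_cos2 y) as E; unfold Rsqr in E.
    replace 1 with ((sin y * sin y) / (sin y) ^ 2) at 1 by (field; lra).
    replace ((/ sin y) ^ 2) with (1 / (sin y) ^ 2) by (field; lra).
    rewrite <- E; field; lra. }
  assert ((/ y) ^ 2 <= (/ sin y) ^ 2) by (apply pow_incr; lra).
  assert (cot y ^ 2 <= (/ y) ^ 2) by (apply pow_incr; lra).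
  apply Rabs_le; lra.
Qed.

Lemma pair_sum_scale s c j d x K :
  c <> 0 -> 0 < x < d ->
  pair_sum s (fun y => (/ y) ^ j) d x K =
  (/ c) ^ j * pair_sum s (fun y => (/ y) ^ j) (d / c) (x / c) K.
Proof.
  intros Hc Hx; unfold pair_sum; rewrite <- sum_lt_scal; apply sum_lt_ext.
  intros n Hn.
  destruct (pair_sum_args_range d x K n Hx Hn) as [H1 H2].
  replace (x + INR n * d) with (c * (x / c + INR n * (d / c))) at 1 by (field; lra).
  replace ((INR n + 1) * d - x) with (c * ((INR n + 1) * (d / c) - x / c)) at 1
    by (field; lra).
  rewrite !Rinv_mult, !Rpow_mult_distr; ring.
Qed.

Lemma pair_sum_minus s phi psi d x K :
  pair_sum s phi d x K - pair_sum s psi d x K =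
  pair_sum s (fun y => phi y - psi y) d x K.
Proof.
  unfold pair_sum.
  replace (sum_lt _ K - sum_lt _ K) with
    (sum_lt (fun n => s ^ n * (phi (x + INR n * d) + phi ((INR n + 1) * d - x))) K +
     (-1) * sum_lt (fun n => s ^ n * (psi (x + INR n * d) + psi ((INR n + 1) * d - x))) K)
    by ring.
  rewrite <- sum_lt_scal, <- sum_lt_plus; apply sum_lt_ext; intros; ring.
Qed.

Lemma dyadic_mesh_range k x :
  0 < x < PI ->
  0 < x / 2 ^ S k < PI / 2 ^ S k /\ INR (2 ^ k) * (PI / 2 ^ S k) = PI / 2.
Proof.
  intros Hx; assert (H2 : 0 < 2 ^ k) by (apply pow_lt; lra).
  change (2 ^ S k) with (2 * 2 ^ k); rewrite INR_pow2; repeat split.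
  - apply Rdiv_lt_0_compat; lra.
  - apply Rmult_lt_compat_r; [apply Rinv_0_lt_compat|]; lra.
  - field; lra.
Qed.

(** In the dyadic identity for [/ sin x], replacing [cot y] by [/ y] costs
    [/ 2 ^ (k + 1)] times two alternating sums of values of the increasing function
    [/ y - cot y], which takes values in [[0, 1]].  What matters is that the bound
    does not depend on [x], so that it survives integration. *)
Lemma csc_partial_fractions k x : 0 < x < PI ->
  Rabs (pair_sum (-1) (fun y => (/ y) ^ 1) PI x (2 ^ k) - / sin x) <= / 2 ^ k.
Proof.
  intros Hx; destruct (dyadic_mesh_range k x Hx) as [Hm HK].
  assert (H2 : 0 < 2 ^ k) by (apply pow_lt; lra).
  rewrite (pair_sum_scale _ (2 ^ S k)) by (try assumption; apply pow_nonzero; lra).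
  rewrite (dyadic_pair_sum cot (fun x => / sin x) (-1) (/ 2) k x); try easy;
    [| ring | apply cot_halve | apply csc_halve ].
  rewrite pow_1, (pow_inv 2 (S k)).
  set (d := PI / _) in *; set (z := x / _) in *.
  rewrite <- Rmult_minus_distr_l, pair_sum_minus, Rabs_mult.
  assert (HP : 0 < / 2 ^ S k) by (apply Rinv_0_lt_compat, pow_lt; lra).
  rewrite (Rabs_pos_eq (/ 2 ^ S k)) by lra.
  (* One unit for each of the two families of arguments. *)
  replace (/ 2 ^ k) with (/ 2 ^ S k * (1 + 1)) by (simpl; field; lra).
  apply Rmult_le_compat_l; [lra|].
  unfold pair_sum.
  rewrite (sum_lt_ext _ (fun n => (-1) ^ n * ((/ (z + INR n * d)) - cot (z + INR n * d))
     + (-1) ^ n * ((/ ((INR n + 1) * d - z)) - cot ((INR n + 1) * d - z))))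
    by (intros; rewrite ?pow_1; ring).
  rewrite sum_lt_plus.
  eapply Rle_trans; [apply Rabs_triang|].
  apply Rplus_le_compat; apply alternating_sum_le; try lra; intros n Hn;
    destruct (pair_sum_args_range d z _ n Hm ltac:(eauto with arith)) as [R1 R2].
  - apply inv_minus_cot_bound; lra.
  - destruct (pair_sum_args_range d z _ _ Hm Hn) as [R3 R4].
    rewrite S_INR in *; apply inv_minus_cot_incr; lra.
  - apply inv_minus_cot_bound; lra.
  - destruct (pair_sum_args_range d z _ _ Hm Hn) as [R3 R4].
    rewrite S_INR in *; apply inv_minus_cot_incr; lra.
Qed.

(** Here there is no cancellation, but the factor in front of the dyadic identity is
    [/ 4 ^ (k + 1)], against [2 ^ (k + 1)] terms that each change by at most 1. *)
Lemma csc_sqr_partial_fractions k x : 0 < x < PI ->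
  Rabs (pair_sum 1 (fun y => (/ y) ^ 2) PI x (2 ^ k) - (/ sin x) ^ 2) <= / 2 ^ k.
Proof.
  intros Hx; destruct (dyadic_mesh_range k x Hx) as [Hm HK].
  assert (H2 : 0 < 2 ^ k) by (apply pow_lt; lra).
  rewrite (pair_sum_scale _ (2 ^ S k)) by (try assumption; apply pow_nonzero; lra).
  rewrite (dyadic_pair_sum (fun x => (/ sin x) ^ 2) (fun x => (/ sin x) ^ 2)
             1 (/ 4) k x); try easy;
    [| ring | intros; rewrite Rmult_1_l; now apply csc_sqr_halve | apply csc_sqr_halve ].
  set (d := PI / _) in *; set (z := x / _) in *.
  replace ((/ 2 ^ S k) ^ 2) with ((/ 4) ^ S k)
    by (replace (/ 4) with ((/ 2) ^ 2) by field;
        rewrite <- pow_inv, <- !pow_mult; f_equal; lia).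
  rewrite <- Rmult_minus_distr_l, pair_sum_minus, Rabs_mult.
  assert (HP : 0 < (/ 4) ^ S k) by (apply pow_lt; lra).
  rewrite (Rabs_pos_eq ((/ 4) ^ S k)) by lra.
  assert (Hb : Rabs (pair_sum 1 (fun y => (/ y) ^ 2 - (/ sin y) ^ 2) d z (2 ^ k))
               <= 2 ^ k * 2).
  { rewrite <- (INR_pow2 k); apply sum_lt_abs_le; intros n Hn.
    destruct (pair_sum_args_range d z _ n Hm Hn) as [R1 R2].
    rewrite pow1, Rmult_1_l.
    eapply Rle_trans; [apply Rabs_triang|].
    replace 2 with (1 + 1) at 5 by ring.
    apply Rplus_le_compat; apply csc_sqr_minus_inv_sqr_bound; lra. }
  apply Rle_trans with ((/ 4) ^ S k * (2 ^ k * 2));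
    [apply Rmult_le_compat_l; lra|].
  replace (/ 4) with (/ 2 * / 2) by field.
  rewrite Rpow_mult_distr, (pow_inv 2 (S k)); simpl.
  replace (/ (2 * 2 ^ k) * / (2 * 2 ^ k) * (2 ^ k * 2)) with (/ 2 * / 2 ^ k)
    by (field; lra).
  assert (0 < / 2 ^ k) by (apply Rinv_0_lt_compat; lra); lra.
Qed.

(** * Improper integrals by folding *)

Lemma is_RInt_shift (g : R -> R) v a b l :
  is_RInt g (a + v) (b + v) l -> is_RInt (fun x => g (x + v)) a b l.
Proof.
  intros H.
  apply is_RInt_ext with (fun x => scal 1 (g (1 * x + v))).
  - intros x _; unfold scal; simpl; unfold mult; simpl.
    now rewrite !Rmult_1_l.
  - apply (is_RInt_comp_lin (V := R_NormedModule) g 1 v a b l).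
    now rewrite !Rmult_1_l.
Qed.

Lemma is_RInt_reflect (g : R -> R) v a b l :
  is_RInt g (v - b) (v - a) l -> is_RInt (fun x => g (v - x)) a b l.
Proof.
  intros H; apply is_RInt_swap in H.
  replace l with (opp (opp l)) by apply opp_opp.
  apply is_RInt_ext with (fun x => opp (scal (-1) (g (-1 * x + v)))).
  - intros x _; unfold scal, opp; simpl; unfold mult; simpl.
    replace (-1 * x + v) with (v - x) by ring; ring.
  - apply (is_RInt_opp (V := R_NormedModule)).
    apply (is_RInt_comp_lin (V := R_NormedModule) g (-1) v a b (opp l)).
    replace (-1 * a + v) with (v - a) by ring.
    replace (-1 * b + v) with (v - b) by ring.
    exact H.
Qed.

Lemma ex_RInt_all_continuous (g : R -> R) a b :
  (forall x, continuous g x) -> ex_RInt g a b.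
Proof. intros Hg; apply (ex_RInt_continuous (V := R_CompleteNormedModule)); auto. Qed.

Lemma RInt_all_continuous (g : R -> R) a b :
  (forall x, continuous g x) -> is_RInt g a b (RInt g a b).
Proof.
  intros Hg; apply (RInt_correct (V := R_CompleteNormedModule)).
  now apply ex_RInt_all_continuous.
Qed.

Lemma RInt_split (g : R -> R) a b c :
  (forall x, continuous g x) -> RInt g a c = RInt g a b + RInt g b c.
Proof.
  intros Hg; symmetry.
  apply (RInt_Chasles (V := R_CompleteNormedModule)); now apply ex_RInt_all_continuous.
Qed.

(** The interval [[n P, (n + 1) P]] is mapped onto [[0, P]] both by translation and
    by reflection; using each once accounts for the factor 2 and produces the
    bilateral sums that occur in partial fractions. *)
Lemma is_RInt_pair_sum (g : R -> R) P K :
  (forall x, continuous g x) ->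
  is_RInt (fun x => pair_sum 1 g P x K) 0 P (2 * RInt g 0 (INR K * P)).
Proof.
  intros Hg; induction K as [|K IH].
  - apply is_RInt_ext with (fun _ => 0); [easy|].
    replace (2 * RInt g 0 (INR 0 * P)) with (scal (P - 0) 0).
    2: { simpl INR; rewrite Rmult_0_l, RInt_point.
         unfold scal, zero; simpl; unfold mult; simpl; ring. }
    apply (is_RInt_const (V := R_NormedModule)).
  - set (I := RInt g (INR K * P) ((INR K + 1) * P)).
    assert (E : RInt g 0 (INR (S K) * P) = RInt g 0 (INR K * P) + I)
      by (rewrite S_INR; now apply RInt_split).
    assert (H1 : is_RInt (fun x => g (x + INR K * P)) 0 P I).
    { apply is_RInt_shift.
      replace (0 + INR K * P) with (INR K * P) by ring.
      replace (P + INR K * P) with ((INR K + 1) * P) by ring.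
      now apply RInt_all_continuous. }
    assert (H2 : is_RInt (fun x => g ((INR K + 1) * P - x)) 0 P I).
    { apply is_RInt_reflect.
      replace ((INR K + 1) * P - P) with (INR K * P) by ring.
      replace ((INR K + 1) * P - 0) with ((INR K + 1) * P) by ring.
      now apply RInt_all_continuous. }
    replace (2 * RInt g 0 (INR (S K) * P))
      with (plus (2 * RInt g 0 (INR K * P)) (plus I I))
      by (rewrite E; unfold plus; simpl; ring).
    eapply is_RInt_ext;
      [| apply (is_RInt_plus (V := R_NormedModule) _ _ _ _ _ _ IH
                  (is_RInt_plus (V := R_NormedModule) _ _ _ _ _ _ H1 H2)) ].
    intros x _; unfold pair_sum, plus; simpl.
    rewrite pow1; ring.
Qed.

(** The tail bound makes the partial integrals Cauchy at infinity, so their limit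
    may be computed along any sequence of endpoints, such as [2 ^ k P]. *)
Lemma is_RInt_0_infty_subsequence (g : R -> R) (u : nat -> R) (C l : R) :
  (forall x, continuous g x) ->
  (forall a b, 0 < a -> a <= b -> Rabs (RInt g a b) <= C / a) ->
  is_lim_seq u p_infty ->
  is_lim_seq (fun k => RInt g 0 (u k)) l ->
  is_RInt_0_infty g l.
Proof.
  intros Hg HC Hu Hl.
  assert (HC0 : 0 <= C).
  { specialize (HC 1 1 ltac:(lra) ltac:(lra)).
    pose proof (Rabs_pos (RInt g 1 1)); lra. }
  assert (Hb : forall b, 0 < b -> Rabs (RInt g 0 b - l) <= C / b).
  { intros b Hb.
    assert (Hlim : is_lim_seq (fun k => Rabs (RInt g 0 (u k) - RInt g 0 b))
                     (Rabs (l - RInt g 0 b))).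
    { apply (is_lim_seq_abs _ (l - RInt g 0 b)).
      apply is_lim_seq_minus'; [exact Hl | apply is_lim_seq_const]. }
    rewrite Rabs_minus_sym.
    apply (is_lim_seq_le_loc _ _ _ (C / b)) with (2 := Hlim) (3 := is_lim_seq_const _).
    apply is_lim_seq_spec in Hu; destruct (Hu b) as [N HN]; exists N.
    intros n Hn; specialize (HN n Hn).
    rewrite (RInt_split g 0 b (u n)) by assumption.
    rewrite Rplus_minus_l.
    apply HC; lra. }
  unfold is_RInt_0_infty, is_RInt_gen.
  intros Q [eps HQ].
  (* The summand 1 keeps [b] positive when [C = 0]. *)
  exists (fun a => a = 0) (fun b => C / eps + 1 < b).
  - reflexivity.
  - now exists (C / eps + 1).
  - intros a b -> Hlt; simpl.
    exists (RInt g 0 b); split; [now apply RInt_all_continuous|].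
    apply HQ; unfold ball; simpl; unfold AbsRing_ball, abs, minus, plus, opp; simpl.
    assert (Heps := cond_pos eps).
    assert (0 <= C / eps) by (apply Rmult_le_pos; [lra|left; now apply Rinv_0_lt_compat]).
    apply Rle_lt_trans with (C / b); [apply Hb; lra|].
    apply (Rmult_lt_reg_r (b / eps));
      [apply Rdiv_lt_0_compat; lra|].
    replace (C / b * (b / eps)) with (C / eps) by (field; lra).
    replace (eps * (b / eps)) with b by (field; lra). lra.
Qed.

(** * Sine-like functions *)

(** All that the two integral formulas use of the sine: both the generalised sine,
    with [P = pi_pq p q], and the ordinary one, with [P = PI], are instances.
    Continuity is asked of [over_id f] because it contains the behaviour at 0;
    that of [f] follows, as [f 0 = 0]. *)
Record sine_like (P : R) (f : R -> R) : Prop := {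
  sl_pos : 0 < P;
  sl_antiperiod : forall x, f (x + P) = - f x;
  sl_reflect : forall x, 0 <= x <= P -> f (P - x) = f x;
  sl_range : forall x, 0 <= x <= P -> 0 <= f x <= 1;
  sl_cont : forall x, continuous (over_id f) x }.

Lemma nonneg_reduce P x : 0 < P -> 0 <= x ->
  exists (n : nat) (t : R), 0 <= t <= P /\ x = t + INR n * P.
Proof.
  intros HP Hx.
  destruct (nfloor_ex (x / P)) as [n Hn].
  { apply Rmult_le_pos; [lra|left; now apply Rinv_0_lt_compat]. }
  exists n, (x - INR n * P); split; [|ring].
  assert (E : x = x / P * P) by (field; lra).
  split; nra.
Qed.

Lemma continuous_Rmult (f g : R -> R) x :
  continuous f x -> continuous g x -> continuous (fun y => f y * g y) x.
Proof. exact (@continuous_mult R_UniformSpace R_AbsRing f g x). Qed.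

Lemma continuous_pow (f : R -> R) j x :
  continuous f x -> continuous (fun y => f y ^ j) x.
Proof.
  intros Hf; induction j as [|j IH]; [apply continuous_const|].
  simpl; now apply continuous_Rmult.
Qed.

(** The value [f P] is [f 0] by reflection and [- f 0] by antiperiodicity. *)
Lemma sine_like_0 P f : sine_like P f -> f 0 = 0.
Proof.
  intros [HP Ha Hr _ _].
  specialize (Ha 0); specialize (Hr 0 ltac:(lra)).
  rewrite Rplus_0_l in Ha; rewrite Rminus_0_r in Hr; lra.
Qed.

Lemma over_id_mult (f : R -> R) x : f 0 = 0 -> x * over_id f x = f x.
Proof.
  intros H0; unfold over_id; destruct (Req_dec_T x 0) as [->|Hx].
  - rewrite H0; ring.
  - field; assumption.
Qed.

Lemma sine_like_continuous P f x : sine_like P f -> continuous f x.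
Proof.
  intros HS.
  apply continuous_ext with (fun y => y * over_id f y).
  - intros y; apply over_id_mult, (sine_like_0 P f HS).
  - apply continuous_Rmult; [apply continuous_id | apply (sl_cont P f HS)].
Qed.

Lemma sine_like_shift P f n x :
  sine_like P f -> f (x + INR n * P) = (-1) ^ n * f x.
Proof.
  intros HS; induction n as [|n IH].
  - simpl; rewrite Rmult_0_l, Rplus_0_r; ring.
  - rewrite S_INR.
    replace (x + (INR n + 1) * P) with (x + INR n * P + P) by ring.
    rewrite (sl_antiperiod P f HS), IH; simpl; ring.
Qed.

Lemma sine_like_abs_le P f x : sine_like P f -> 0 <= x -> Rabs (f x) <= 1.
Proof.
  intros HS Hx.
  destruct (nonneg_reduce P x (sl_pos P f HS) Hx) as [n [t [Ht ->]]].
  rewrite (sine_like_shift P f n t HS), Rabs_mult, <- RPow_abs, Rabs_m1, pow1.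
  pose proof (sl_range P f HS t Ht); rewrite Rabs_pos_eq; lra.
Qed.

(** The primitive [T] satisfies [T (x + P) = T P - T x], so the bounds propagate from
    one half period to the next. *)
Lemma sine_like_primitive_bounded P f x :
  sine_like P f -> 0 <= x -> 0 <= RInt f 0 x <= RInt f 0 P.
Proof.
  intros HS Hx.
  assert (Hc : forall y, continuous f y) by (intros; now apply (sine_like_continuous P)).
  assert (Hpos := sl_pos P f HS).
  assert (Hnn : forall a b, 0 <= a -> a <= b -> b <= P -> 0 <= RInt f a b).
  { intros a b Ha Hab Hb; apply RInt_ge_0; [easy|now apply ex_RInt_all_continuous|].
    intros t Ht; apply (sl_range P f HS); lra. }
  destruct (nonneg_reduce P x Hpos Hx) as [n [t [Ht ->]]].
  clear Hx; induction n as [|n IH].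
  - simpl; rewrite Rmult_0_l, Rplus_0_r.
    pose proof (Hnn 0 t); pose proof (Hnn t P).
    rewrite (RInt_split f 0 t P) by assumption; lra.
  - set (y := t + INR n * P) in *.
    replace (t + INR (S n) * P) with (y + P) by (unfold y; rewrite S_INR; ring).
    assert (E : RInt f P (y + P) = - RInt f 0 y).
    { transitivity (RInt (fun z => f (z + P)) 0 y).
      - symmetry; apply (is_RInt_unique (V := R_CompleteNormedModule)), is_RInt_shift.
        rewrite Rplus_0_l; now apply RInt_all_continuous.
      - apply (is_RInt_unique (V := R_CompleteNormedModule)).
        apply is_RInt_ext with (fun z => opp (f z)).
        + intros z _; symmetry; apply (sl_antiperiod P f HS).
        + apply (is_RInt_opp (V := R_NormedModule)); now apply RInt_all_continuous. }
    rewrite (RInt_split f 0 P (y + P)), E by assumption; lra.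
Qed.

Lemma over_id_neq (f : R -> R) x : x <> 0 -> over_id f x = f x / x.
Proof. intros Hx; unfold over_id; now destruct (Req_dec_T x 0). Qed.

Lemma is_RInt_inv_sqr a b : 0 < a -> a <= b ->
  is_RInt (fun x => (/ x) ^ 2) a b (/ a - / b).
Proof.
  intros Ha Hab.
  replace (/ a - / b) with (minus (- / b) (- / a))
    by (unfold minus, plus, opp; simpl; ring).
  apply (is_RInt_derive (V := R_CompleteNormedModule) (fun x => - / x));
    rewrite Rmin_left, Rmax_right by lra; intros x Hx.
  - auto_derive; [lra|field; lra].
  - apply (ex_derive_continuous (V := R_NormedModule)); auto_derive; lra.
Qed.

Lemma RInt_abs_le (f g : R -> R) a b :
  a <= b -> ex_RInt f a b -> ex_RInt g a b ->
  (forall x, a < x < b -> Rabs (f x) <= g x) ->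
  Rabs (RInt f a b) <= RInt g a b.
Proof.
  intros Hab Hf Hg H.
  apply Rabs_le; split.
  - replace (- RInt g a b) with (RInt (fun x => opp (g x)) a b)
      by now rewrite (RInt_opp (V := R_CompleteNormedModule)).
    apply RInt_le; [easy | now apply (ex_RInt_opp (V := R_NormedModule)) | easy |].
    intros x Hx; specialize (H x Hx); apply Rabs_le_between in H.
    unfold opp; simpl; lra.
  - apply RInt_le; try easy.
    intros x Hx; specialize (H x Hx); apply Rabs_le_between in H; lra.
Qed.

(** Integration by parts: with [T] the bounded primitive of [f], the integral
    of [f x / x] is a boundary term plus the integral of [T x / x ^ 2]. *)
Lemma sine_like_over_id_tail P f a b : sine_like P f -> 0 < a -> a <= b ->
  Rabs (RInt (fun x => over_id f x ^ 1) a b) <= 2 * RInt f 0 P / a.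
Proof.
  intros HS Ha Hab.
  assert (Hc : forall y, continuous f y) by (intros; now apply (sine_like_continuous P)).
  set (T := fun x => RInt f 0 x).
  assert (HT : forall x, is_derive T x (f x)).
  { intros x; apply (is_derive_RInt (V := R_CompleteNormedModule) f T 0 x); [|apply Hc].
    apply filter_forall; intros y; now apply RInt_all_continuous. }
  assert (HTb : forall x, 0 <= x -> 0 <= T x <= T P)
    by (intros; now apply (sine_like_primitive_bounded P)).
  change (RInt f 0 P) with (T P); clearbody T.
  assert (HTc : forall x, continuous T x).
  { intros x; apply (ex_derive_continuous (V := R_NormedModule)); now exists (f x). }
  assert (Hsc : forall x, a <= x <= b -> continuous (fun x => (/ x) ^ 2) x).
  { intros x Hx; apply (ex_derive_continuous (V := R_NormedModule)); auto_derive; lra. }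
  assert (H1 : is_RInt (fun x => f x / x - T x * (/ x) ^ 2) a b (T b / b - T a / a)).
  { apply (is_RInt_derive (V := R_CompleteNormedModule) (fun x => T x / x));
      rewrite Rmin_left, Rmax_right by lra; intros x Hx.
    - auto_derive; [split; [now exists (f x)|lra]|].
      replace (Derive _ x) with (f x) by (symmetry; apply is_derive_unique, HT).
      field; lra.
    - apply (continuous_minus (V := R_NormedModule)); apply continuous_Rmult; auto.
      apply (ex_derive_continuous (V := R_NormedModule)); auto_derive; lra. }
  assert (He : ex_RInt (fun x => T x * (/ x) ^ 2) a b).
  { apply (ex_RInt_continuous (V := R_CompleteNormedModule)).
    rewrite Rmin_left, Rmax_right by lra; intros x Hx; apply continuous_Rmult; auto. }
  pose proof (RInt_correct (V := R_CompleteNormedModule) _ _ _ He) as H2.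
  pose proof (is_RInt_inv_sqr a b Ha Hab) as H3.
  assert (H4 : Rabs (RInt (fun x => T x * (/ x) ^ 2) a b) <= T P * (/ a - / b)).
  { apply (is_RInt_scal (V := R_NormedModule) _ _ _ (T P)) in H3.
    replace (T P * (/ a - / b)) with (RInt (fun x => scal (T P) ((/ x) ^ 2)) a b)
      by (apply (is_RInt_unique (V := R_CompleteNormedModule)); exact H3).
    apply RInt_abs_le; try easy; [eexists; exact H3|].
    intros x Hx; specialize (HTb x ltac:(lra)).
    assert (0 <= (/ x) ^ 2) by (apply pow_le; left; apply Rinv_0_lt_compat; lra).
    rewrite Rabs_pos_eq by (apply Rmult_le_pos; lra).
    apply Rmult_le_compat_r; lra. }
  assert (E : RInt (fun x => over_id f x ^ 1) a b =
              T b / b - T a / a + RInt (fun x => T x * (/ x) ^ 2) a b).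
  { apply (is_RInt_unique (V := R_CompleteNormedModule)).
    eapply is_RInt_ext; [|apply (is_RInt_plus (V := R_NormedModule) _ _ _ _ _ _ H1 H2)].
    rewrite Rmin_left, Rmax_right by lra; intros x Hx.
    rewrite over_id_neq by lra; unfold plus; simpl; ring. }
  rewrite E.
  assert (Hia : 0 < / a) by now apply Rinv_0_lt_compat.
  assert (Hib : 0 < / b) by (apply Rinv_0_lt_compat; lra).
  assert (Hba : / b <= / a) by (apply Rinv_le_contravar; lra).
  pose proof (HTb a ltac:(lra)) as Ta; pose proof (HTb b ltac:(lra)) as Tb.
  assert (0 <= T a / a <= T P / a) by (unfold Rdiv; split; nra).
  assert (0 <= T b / b <= T P / b) by (unfold Rdiv; split; nra).
  assert (T P / b <= T P / a) by (unfold Rdiv; nra).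
  apply Rabs_le_between in H4; apply Rabs_le; unfold Rdiv in *; lra.
Qed.

Lemma sine_like_over_id_sqr_tail P f a b : sine_like P f -> 0 < a -> a <= b ->
  Rabs (RInt (fun x => over_id f x ^ 2) a b) <= 1 / a.
Proof.
  intros HS Ha Hab.
  pose proof (is_RInt_inv_sqr a b Ha Hab) as H3.
  apply Rle_trans with (/ a - / b).
  - rewrite <- (is_RInt_unique (V := R_CompleteNormedModule) _ _ _ _ H3).
    apply RInt_abs_le; [easy| |eexists; exact H3|].
    + apply ex_RInt_all_continuous; intros x; apply continuous_pow, (sl_cont P f HS).
    + intros x Hx; rewrite over_id_neq by lra.
      unfold Rdiv; rewrite Rpow_mult_distr, Rabs_mult, <- RPow_abs.
      assert (0 <= (/ x) ^ 2) by (apply pow_le; left; apply Rinv_0_lt_compat; lra).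
      rewrite (Rabs_pos_eq ((/ x) ^ 2)) by assumption.
      assert (Rabs (f x) ^ 2 <= 1 ^ 2)
        by (apply pow_incr; split; [apply Rabs_pos|apply (sine_like_abs_le P f _ HS); lra]).
      nra.
  - assert (0 < / b) by (apply Rinv_0_lt_compat; lra); unfold Rdiv; lra.
Qed.

(** The antiperiodicity and the reflection formula turn the folded values of
    [f y / y] into [f x] times the partial sums of the expansion of [/ sin] at
    [PI x / P].  The exponent [j] is 1 or 2 in the applications; it turns the sign
    [-1] into [(-1) ^ j]. *)
Lemma sine_like_pair_sum P f j x K : sine_like P f -> 0 < x < P ->
  pair_sum 1 (fun y => over_id f y ^ j) P x K =
  (f x) ^ j * (PI / P) ^ j *
  pair_sum ((-1) ^ j) (fun y => (/ y) ^ j) PI (PI / P * x) K.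
Proof.
  intros HS Hx; pose proof PI_RGT_0.
  assert (Hc : 0 < PI / P) by (apply Rdiv_lt_0_compat; lra).
  unfold pair_sum; rewrite <- sum_lt_scal; apply sum_lt_ext; intros n Hn.
  destruct (pair_sum_args_range P x K n Hx Hn) as [H1 H2].
  rewrite !over_id_neq by lra.
  rewrite (sine_like_shift P f n x HS).
  replace ((INR n + 1) * P - x) with (P - x + INR n * P) at 1 by ring.
  rewrite (sine_like_shift P f n _ HS), (sl_reflect P f HS) by lra.
  replace (PI / P * x + INR n * PI) with (PI / P * (x + INR n * P)) by (field; lra).
  replace ((INR n + 1) * PI - PI / P * x) with (PI / P * ((INR n + 1) * P - x))
    by (field; lra).
  unfold Rdiv at 1 2.
  rewrite pow1, !Rinv_mult, !Rpow_mult_distr, <- !pow_mult, (Nat.mul_comm j n).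
  assert (E : (PI / P) ^ j * (/ (PI / P)) ^ j = 1)
    by (rewrite <- Rpow_mult_distr, Rinv_r, pow1; lra).
  transitivity (((PI / P) ^ j * (/ (PI / P)) ^ j) *
     ((-1) ^ (n * j) * f x ^ j * (/ (x + INR n * P)) ^ j +
      (-1) ^ (n * j) * f x ^ j * (/ ((INR n + 1) * P - x)) ^ j)).
  - rewrite E; ring.
  - ring.
Qed.

Lemma continuous_over_id (f : R -> R) :
  f 0 = 0 -> derivable_pt_lim f 0 1 -> (forall x, continuous f x) ->
  forall x, continuous (over_id f) x.
Proof.
  intros H0 Hd Hc x; destruct (Req_dec x 0) as [->|Hx].
  - intros Q [eps HQ].
    destruct (Hd eps (cond_pos eps)) as [delta Hdelta].
    exists delta; intros y Hy; apply HQ.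
    unfold ball in *; simpl in *; unfold AbsRing_ball, abs, minus, plus, opp in *;
      simpl in *.
    replace (over_id f 0) with 1
      by (unfold over_id; destruct (Req_dec_T 0 0); [easy|lra]).
    destruct (Req_dec y 0) as [->|Hy0].
    + unfold over_id; destruct (Req_dec_T 0 0); [|lra].
      rewrite Rplus_opp_r, Rabs_R0; apply cond_pos.
    + rewrite over_id_neq by assumption.
      specialize (Hdelta y Hy0); rewrite Rplus_0_l, H0, Rminus_0_r in Hdelta.
      apply Hdelta; now rewrite Ropp_0, Rplus_0_r in Hy.
  - apply continuous_ext_loc with (fun y => f y * / y).
    + exists (mkposreal (Rabs x) (Rabs_pos_lt x Hx)); intros y Hy.
      symmetry; apply over_id_neq; intros ->.
      unfold ball in Hy; simpl in Hy; unfold AbsRing_ball, abs, minus, plus, opp in Hy;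
        simpl in Hy.
      rewrite Rplus_0_l, Rabs_Ropp in Hy; lra.
    + apply continuous_Rmult; [apply Hc|].
      apply continuous_Rinv_comp; [apply continuous_id|assumption].
Qed.

Lemma sine_like_sin : sine_like PI sin.
Proof.
  pose proof PI_RGT_0; split.
  - assumption.
  - apply neg_sin.
  - intros x _; apply sin_PI_x.
  - intros x Hx; split; [apply sin_ge_0|apply SIN_bound]; lra.
  - apply continuous_over_id; [apply sin_0| |].
    + rewrite <- cos_0; apply derivable_pt_lim_sin.
    + intros x; apply continuous_sin.
Qed.

Lemma over_id_sin_pos x : 0 <= x < PI -> 0 < over_id sin x.
Proof.
  intros Hx; unfold over_id; destruct (Req_dec_T x 0); [lra|].
  apply Rdiv_lt_0_compat; [apply sin_gt_0|]; lra.
Qed.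

(** On the first half of the interval the quotient equals a continuous function
    built from [over_id f] and [over_id sin]; the second half is its mirror image. *)
Lemma sine_like_quotient_ex_RInt P f j : sine_like P f ->
  ex_RInt (fun x => (f (P * x) / sin (PI * x)) ^ j) 0 1.
Proof.
  intros HS; pose proof PI_RGT_0; assert (HP := sl_pos P f HS).
  set (h := fun x => _).
  assert (H1 : ex_RInt h 0 (/ 2)).
  { apply ex_RInt_ext with
      (fun x => (over_id f (P * x) * (P / PI) * / over_id sin (PI * x)) ^ j).
    - rewrite Rmin_left, Rmax_right by lra; intros x Hx.
      unfold h; f_equal.
      assert (0 < sin (PI * x)) by (apply sin_gt_0; nra).
      rewrite !over_id_neq by nra; field; repeat split; nra.
    - apply (ex_RInt_continuous (V := R_CompleteNormedModule)).
      rewrite Rmin_left, Rmax_right by lra; intros x Hx.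
      apply continuous_pow, continuous_Rmult; [apply continuous_Rmult|].
      + apply (continuous_comp (fun x => P * x) (over_id f)); [|apply (sl_cont P f HS)].
        apply continuous_Rmult; [apply continuous_const|apply continuous_id].
      + apply continuous_const.
      + apply continuous_Rinv_comp.
        * apply (continuous_comp (fun x => PI * x) (over_id sin));
            [|apply (sl_cont PI sin sine_like_sin)].
          apply continuous_Rmult; [apply continuous_const|apply continuous_id].
        * apply Rgt_not_eq, over_id_sin_pos; nra. }
  destruct H1 as [I H1].
  apply (ex_RInt_Chasles (V := R_NormedModule) h 0 (/ 2) 1); [now exists I|].
  exists I.
  apply is_RInt_ext with (fun x => h (1 - x)).
  - rewrite Rmin_left, Rmax_right by lra; intros x Hx; unfold h.
    replace (P * (1 - x)) with (P - P * x) by ring.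
    replace (PI * (1 - x)) with (PI - PI * x) by ring.
    rewrite sin_PI_x, (sl_reflect P f HS) by nra; reflexivity.
  - apply is_RInt_reflect.
    replace (1 - 1) with 0 by ring; replace (1 - / 2) with (/ 2) by field; exact H1.
Qed.

(** Twice the integral of [(f y / y) ^ j] up to [2 ^ k P] is the integral over [[0, P]]
    of a folded sum that tends uniformly to [(f x * (PI / P) / sin (PI x / P)) ^ j];
    the change of variable [x = P u] gives the value. *)
Lemma sine_like_integral P f j C : sine_like P f ->
  (forall k x, 0 < x < PI ->
    Rabs (pair_sum ((-1) ^ j) (fun y => (/ y) ^ j) PI x (2 ^ k) - (/ sin x) ^ j)
      <= / 2 ^ k) ->
  (forall a b, 0 < a -> a <= b ->
    Rabs (RInt (fun x => over_id f x ^ j) a b) <= C / a) ->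
  is_RInt_0_infty (fun x => over_id f x ^ j)
    ((PI / P) ^ j * P / 2 * RInt (fun x => (f (P * x) / sin (PI * x)) ^ j) 0 1).
Proof.
  intros HS Hpf Htail; pose proof PI_RGT_0; assert (HP := sl_pos P f HS).
  set (g := fun x => over_id f x ^ j).
  set (h := fun x => (f (P * x) / sin (PI * x)) ^ j).
  set (J := RInt h 0 1).
  assert (Hg : forall x, continuous g x)
    by (intros x; apply continuous_pow, (sl_cont P f HS)).
  assert (Hc : 0 < PI / P) by (apply Rdiv_lt_0_compat; lra).
  set (A := (PI / P) ^ j); assert (HA : 0 < A) by now apply pow_lt.
  set (D := fun x => f x ^ j * A * (/ sin (PI / P * x)) ^ j).
  assert (HD : is_RInt D 0 P (A * P * J)).
  { assert (HJ : is_RInt h 0 1 J)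
      by (apply (RInt_correct (V := R_CompleteNormedModule)),
          sine_like_quotient_ex_RInt, HS).
    replace (A * P * J) with (scal (A * P) J) by reflexivity.
    apply is_RInt_ext with (fun x => scal (A * P) (scal (/ P) (h (/ P * x + 0)))).
    - intros x _; unfold scal; simpl; unfold mult; simpl; unfold h, D.
      replace (P * (/ P * x + 0)) with x by (field; lra).
      replace (PI * (/ P * x + 0)) with (PI / P * x) by (field; lra).
      unfold Rdiv at 1; rewrite Rpow_mult_distr; field; lra.
    - apply (is_RInt_scal (V := R_NormedModule)).
      apply (is_RInt_comp_lin (V := R_NormedModule) h (/ P) 0 0 P J).
      replace (/ P * 0 + 0) with 0 by ring.
      replace (/ P * P + 0) with 1 by (field; lra); exact HJ. }
  assert (Hk : forall k, Rabs (RInt g 0 (INR (2 ^ k) * P) - A * P / 2 * J)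
                         <= A * P * / 2 ^ k).
  { intros k.
    assert (Hk0 : 0 < / 2 ^ k) by (apply Rinv_0_lt_compat, pow_lt; lra).
    pose proof (is_RInt_minus (V := R_NormedModule) _ _ _ _ _ _
                  (is_RInt_pair_sum g P (2 ^ k) Hg) HD) as HM.
    assert (HB : Rabs (2 * RInt g 0 (INR (2 ^ k) * P) - A * P * J) <= A * P * / 2 ^ k).
    { rewrite <- (is_RInt_unique (V := R_CompleteNormedModule) _ _ _ _ HM : _ = _ - _).
      replace (A * P * / 2 ^ k) with (RInt (fun _ => A * / 2 ^ k) 0 P)
        by (rewrite RInt_const; unfold scal; simpl; unfold mult; simpl; ring).
      apply RInt_abs_le; [lra|eexists; exact HM|apply ex_RInt_const|].
      intros x Hx.
      unfold g, D; rewrite (sine_like_pair_sum P f j x _ HS Hx); fold A.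
      unfold minus, plus, opp; simpl.
      match goal with |- Rabs (?u * ?v + - (?u * ?w)) <= _ =>
        replace (u * v + - (u * w)) with (u * (v - w)) by ring end.
      assert (HSx : Rabs (f x ^ j) <= 1).
      { rewrite <- RPow_abs, <- (pow1 j); apply pow_incr.
        split; [apply Rabs_pos|apply (sine_like_abs_le P f _ HS); lra]. }
      assert (Hx' : 0 < PI / P * x < PI).
      { split; [nra|]. replace PI with (PI / P * P) at 2 by (field; lra).
        apply Rmult_lt_compat_l; lra. }
      specialize (Hpf k _ Hx').
      rewrite !Rabs_mult, (Rabs_pos_eq A) by lra.
      apply Rmult_le_compat; [|apply Rabs_pos| |exact Hpf];
        pose proof (Rabs_pos (f x ^ j)); nra. }
    replace (RInt g 0 (INR (2 ^ k) * P) - A * P / 2 * J)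
      with (/ 2 * (2 * RInt g 0 (INR (2 ^ k) * P) - A * P * J)) by field.
    rewrite Rabs_mult, Rabs_pos_eq by lra.
    pose proof (Rabs_pos (2 * RInt g 0 (INR (2 ^ k) * P) - A * P * J)); lra. }
  assert (H2 : is_lim_seq (fun k => 2 ^ k) p_infty) by (apply is_lim_seq_geom_p; lra).
  apply (is_RInt_0_infty_subsequence g (fun k => INR (2 ^ k) * P) C); try assumption.
  - apply is_lim_seq_ext with (fun k => 2 ^ k * P); [intros; now rewrite INR_pow2|].
    replace p_infty with (Rbar_mult p_infty P).
    + apply is_lim_seq_scal_r, H2.
    + simpl; destruct (Rle_dec 0 P) as [h1|]; [|lra].
      destruct (Rle_lt_or_eq_dec 0 P h1); [easy|lra].
  - assert (H3 : is_lim_seq (fun k => A * P * / 2 ^ k) 0).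
    { replace (Finite 0) with (Rbar_mult (A * P) 0) by (simpl; f_equal; ring).
      apply is_lim_seq_scal_l.
      replace (Finite 0) with (Rbar_inv p_infty) by reflexivity.
      apply is_lim_seq_inv; easy. }
    apply is_lim_seq_ext with
      (fun k => (RInt g 0 (INR (2 ^ k) * P) - A * P / 2 * J) + A * P / 2 * J);
      [intros; ring|].
    replace (Finite (A * P / 2 * J)) with (Finite (0 + A * P / 2 * J)) by (f_equal; ring).
    apply is_lim_seq_plus'; [|apply is_lim_seq_const].
    apply is_lim_seq_abs_0.
    apply is_lim_seq_le_le with (fun _ => 0) (fun k => A * P * / 2 ^ k);
      [|apply is_lim_seq_const|exact H3].
    intros k; split; [apply Rabs_pos|apply Hk].
Qed.

Lemma sine_like_integrals P f : sine_like P f ->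
  (ex_RInt (fun x => f (P * x) / sin (PI * x)) 0 1 /\
   is_RInt_0_infty (over_id f)
     (PI / 2 * RInt (fun x => f (P * x) / sin (PI * x)) 0 1)) /\
  (ex_RInt (fun x => (f (P * x) / sin (PI * x)) ^ 2) 0 1 /\
   is_RInt_0_infty (fun x => over_id f x ^ 2)
     (PI ^ 2 / (2 * P) * RInt (fun x => (f (P * x) / sin (PI * x)) ^ 2) 0 1)).
Proof.
  intros HS; assert (HP := sl_pos P f HS).
  assert (E : forall g : R -> R, (fun x => g x ^ 1) = g)
    by (intros g; apply functional_extensionality; intros x; apply pow_1).
  split; split.
  - rewrite <- (E (fun x => f (P * x) / sin (PI * x))); now apply sine_like_quotient_ex_RInt.
  - replace (PI / 2) with ((PI / P) ^ 1 * P / 2) by (field; lra).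
    rewrite <- (E (over_id f)), <- (E (fun x => f (P * x) / sin (PI * x))).
    apply (sine_like_integral P f 1 (2 * RInt f 0 P) HS).
    + intros k x Hx; rewrite !pow_1; now apply csc_partial_fractions.
    + intros a b Ha Hab; now apply sine_like_over_id_tail.
  - now apply sine_like_quotient_ex_RInt.
  - replace (PI ^ 2 / (2 * P)) with ((PI / P) ^ 2 * P / 2) by (field; lra).
    apply (sine_like_integral P f 2 1 HS).
    + intros k x Hx; replace ((-1) ^ 2) with 1 by ring.
      now apply csc_sqr_partial_fractions.
    + intros a b Ha Hab; now apply (sine_like_over_id_sqr_tail P).
Qed.

Lemma sin_integrals :
  is_RInt_0_infty (over_id sin) (PI / 2) /\
  is_RInt_0_infty (fun x => over_id sin x ^ 2) (PI / 2).
Proof.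
  pose proof PI_RGT_0.
  destruct (sine_like_integrals PI sin sine_like_sin) as [[_ H1] [_ H2]].
  assert (Hs : forall x, Rmin 0 1 < x < Rmax 0 1 -> 0 < sin (PI * x)).
  { rewrite Rmin_left, Rmax_right by lra; intros x Hx; apply sin_gt_0; nra. }
  assert (Hq : forall x, Rmin 0 1 < x < Rmax 0 1 -> sin (PI * x) / sin (PI * x) = 1)
    by (intros x Hx; specialize (Hs x Hx); field; lra).
  rewrite (RInt_ext _ (fun _ => 1)) in H1 by exact Hq.
  rewrite (RInt_ext _ (fun _ => 1)) in H2
    by (intros x Hx; rewrite Hq by assumption; apply pow1).
  rewrite RInt_const in H1, H2; unfold scal in H1, H2; simpl in H1, H2.
  unfold mult in H1, H2; simpl in H1, H2.
  replace (PI / 2 * ((1 - 0) * 1)) with (PI / 2) in H1 by field.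
  replace (PI * (PI * 1) / (2 * PI) * ((1 - 0) * 1)) with (PI / 2) in H2 by (field; lra).
  now split.
Qed.

(** * The generalised sine *)

Lemma rpow_nonpos x a : x <= 0 -> rpow x a = 0.
Proof. intros Hx; unfold rpow; destruct (Rlt_dec 0 x); [lra|easy]. Qed.

Lemma rpow_pos x a : 0 < x -> rpow x a = Rpower x a.
Proof. intros Hx; unfold rpow; now destruct (Rlt_dec 0 x). Qed.

Lemma ln_nonpos x : 0 < x <= 1 -> ln x <= 0.
Proof.
  intros Hx; rewrite <- ln_1; destruct (Req_dec x 1) as [->|H]; [lra|].
  left; apply ln_increasing; lra.
Qed.

Lemma exp_le_mono x y : x <= y -> exp x <= exp y.
Proof. intros [H | ->]; [left; now apply exp_increasing|lra]. Qed.

Lemma rpow_le_id t q : 1 < q -> 0 <= t <= 1 -> 0 <= rpow t q <= t.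
Proof.
  intros Hq [[Ht | <-] Ht1]; [|rewrite rpow_nonpos; lra].
  rewrite rpow_pos by assumption; unfold Rpower; split; [left; apply exp_pos|].
  rewrite <- (exp_ln t) at 2 by assumption; apply exp_le_mono.
  pose proof (ln_nonpos t ltac:(lra)); nra.
Qed.

Lemma rpow_lt_1 t q : 1 < q -> t < 1 -> 0 <= rpow t q < 1.
Proof.
  intros Hq Ht; destruct (Rle_dec t 0) as [H|H]; [rewrite rpow_nonpos; lra|].
  pose proof (rpow_le_id t q Hq ltac:(lra)); lra.
Qed.

Lemma continuous_rpow_pos a x : 0 < x -> continuous (fun x => rpow x a) x.
Proof.
  intros Hx; apply continuous_ext_loc with (fun x => exp (a * ln x)).
  - exists (mkposreal x Hx); intros y Hy.
    unfold ball in Hy; simpl in Hy; unfold AbsRing_ball, abs, minus, plus, opp in Hy;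
      simpl in Hy; apply Rabs_lt_between in Hy.
    rewrite rpow_pos by lra; reflexivity.
  - apply (ex_derive_continuous (V := R_NormedModule)); auto_derive; lra.
Qed.

Lemma continuous_rpow q x : 1 < q -> continuous (fun x => rpow x q) x.
Proof.
  intros Hq; destruct (Rlt_dec 0 x) as [Hx|Hx]; [now apply continuous_rpow_pos|].
  intros Q [eps HQ].
  assert (Hd : 0 < Rmin eps 1) by (apply Rmin_pos; [apply cond_pos|lra]).
  exists (mkposreal _ Hd); intros y Hy; apply HQ.
  unfold ball in *; simpl in *; unfold AbsRing_ball, abs, minus, plus, opp in *;
    simpl in *; apply Rabs_lt_between in Hy.
  pose proof (Rmin_l eps 1); pose proof (Rmin_r eps 1); pose proof (cond_pos eps).
  rewrite (rpow_nonpos x) by lra.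
  destruct (Rle_dec y 0).
  - rewrite rpow_nonpos, Ropp_0, Rplus_0_r, Rabs_R0 by lra; lra.
  - pose proof (rpow_le_id y q Hq ltac:(lra)).
    rewrite Rabs_pos_eq; lra.
Qed.

Lemma F_integrand_ge_1 p q t : 1 < p -> 1 < q -> t < 1 -> 1 <= F_integrand p q t.
Proof.
  intros Hp Hq Ht; unfold F_integrand.
  pose proof (rpow_lt_1 t q Hq Ht).
  rewrite rpow_pos by lra; unfold Rpower.
  rewrite <- exp_0 at 1; apply exp_le_mono.
  pose proof (ln_nonpos (1 - rpow t q) ltac:(lra)).
  assert (0 < 1 / p) by (apply Rdiv_lt_0_compat; lra).
  set (c := 1 / p) in *; nra.
Qed.

Lemma F_integrand_0 p q : F_integrand p q 0 = 1.
Proof.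
  unfold F_integrand; rewrite (rpow_nonpos 0) by lra.
  rewrite rpow_pos by lra; unfold Rpower.
  rewrite Rminus_0_r, ln_1, Rmult_0_r; apply exp_0.
Qed.

Lemma continuous_F_integrand p q t : 1 < q -> t < 1 -> continuous (F_integrand p q) t.
Proof.
  intros Hq Ht; unfold F_integrand.
  apply (continuous_comp (fun t => 1 - rpow t q) (fun u => rpow u (- (1 / p)))).
  - apply (continuous_minus (V := R_NormedModule));
      [apply continuous_const|now apply continuous_rpow].
  - apply continuous_rpow_pos; pose proof (rpow_lt_1 t q Hq Ht); lra.
Qed.

Lemma ex_RInt_F_integrand p q a b : 1 < q -> a < 1 -> b < 1 ->
  ex_RInt (F_integrand p q) a b.
Proof.
  intros Hq Ha Hb; apply (ex_RInt_continuous (V := R_CompleteNormedModule)).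
  intros t [_ Ht]; apply continuous_F_integrand; [assumption|].
  eapply Rle_lt_trans; [exact Ht|]; now apply Rmax_lub_lt.
Qed.

Lemma F_pq_lt_1 p q x : x < 1 -> F_pq p q x = RInt (F_integrand p q) 0 x.
Proof. intros Hx; unfold F_pq; now destruct (Rlt_dec x 1). Qed.

Lemma F_pq_0 p q : F_pq p q 0 = 0.
Proof. rewrite F_pq_lt_1, RInt_point by lra; reflexivity. Qed.

Lemma is_derive_F_pq p q x : 1 < q -> x < 1 ->
  is_derive (F_pq p q) x (F_integrand p q x).
Proof.
  intros Hq Hx.
  apply (is_derive_RInt (V := R_NormedModule) _ _ 0); [|now apply continuous_F_integrand].
  assert (Hd : 0 < 1 - x) by lra.
  exists (mkposreal _ Hd); intros y Hy.
  unfold ball in Hy; simpl in Hy; unfold AbsRing_ball, abs, minus, plus, opp in Hy;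
    simpl in Hy; apply Rabs_lt_between in Hy.
  rewrite F_pq_lt_1 by lra.
  apply (RInt_correct (V := R_CompleteNormedModule)), ex_RInt_F_integrand; lra.
Qed.

Lemma F_pq_expanding_lt_1 p q x y : 1 < p -> 1 < q -> x <= y -> y < 1 ->
  y - x <= F_pq p q y - F_pq p q x.
Proof.
  intros Hp Hq Hxy Hy; rewrite !F_pq_lt_1 by lra.
  rewrite <- (RInt_Chasles (V := R_CompleteNormedModule) _ 0 x y)
    by (apply ex_RInt_F_integrand; lra).
  unfold plus; simpl; rewrite Rplus_minus_l.
  replace (y - x) with (RInt (fun _ => 1) x y)
    by (rewrite RInt_const; unfold scal; simpl; unfold mult; simpl; ring).
  apply RInt_le; [easy|apply ex_RInt_const|apply ex_RInt_F_integrand; lra|].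
  intros t Ht; apply F_integrand_ge_1; lra.
Qed.

Lemma F_integrand_le p q t : 1 < p -> 1 < q -> 0 <= t < 1 ->
  F_integrand p q t <= Rpower (1 - t) (- (1 / p)).
Proof.
  intros Hp Hq Ht; unfold F_integrand.
  pose proof (rpow_le_id t q Hq ltac:(lra)).
  rewrite rpow_pos by lra; unfold Rpower; apply exp_le_mono.
  assert (ln (1 - t) <= ln (1 - rpow t q)) by (apply ln_le; lra).
  assert (0 < 1 / p) by (apply Rdiv_lt_0_compat; lra).
  set (c := 1 / p) in *; nra.
Qed.

(** Comparison with [(1 - t) ^ (- 1 / p)], which is integrable up to 1 since [p > 1]. *)
Lemma F_pq_bounded p q x : 1 < p -> 1 < q -> 0 <= x < 1 ->
  F_pq p q x <= / (1 - 1 / p).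
Proof.
  intros Hp Hq Hx; rewrite F_pq_lt_1 by lra.
  set (c := 1 - 1 / p).
  assert (Hc : 0 < c).
  { unfold c; assert (1 / p < 1); [|lra].
    apply (Rmult_lt_reg_r p); [lra|]; unfold Rdiv.
    rewrite Rmult_assoc, Rinv_l; lra. }
  assert (HG : is_RInt (fun t => Rpower (1 - t) (- (1 / p))) 0 x
                 (minus (- Rpower (1 - x) c / c) (- Rpower (1 - 0) c / c))).
  { apply (is_RInt_derive (V := R_CompleteNormedModule) (fun t => - Rpower (1 - t) c / c));
      rewrite Rmin_left, Rmax_right by lra; intros t Ht.
    - unfold Rpower; auto_derive; [lra|].
      replace (- (1 / p)) with (c - 1) by (unfold c; ring).
      replace ((c - 1) * ln (1 - t)) with (c * ln (1 + - t) + - ln (1 - t))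
        by (unfold Rminus; ring).
      rewrite exp_plus, exp_Ropp, exp_ln by lra.
      field; lra.
    - unfold Rpower; apply (ex_derive_continuous (V := R_NormedModule)).
      auto_derive; lra. }
  apply Rle_trans with (RInt (fun t => Rpower (1 - t) (- (1 / p))) 0 x).
  - apply RInt_le; [lra|apply ex_RInt_F_integrand; lra|eexists; exact HG|].
    intros t Ht; apply F_integrand_le; lra.
  - rewrite (is_RInt_unique (V := R_CompleteNormedModule) _ _ _ _ HG).
    unfold minus, plus, opp; simpl.
    assert (E : Rpower (1 - 0) c = 1)
      by (unfold Rpower; rewrite Rminus_0_r, ln_1, Rmult_0_r; apply exp_0).
    rewrite E.
    assert (0 < Rpower (1 - x) c) by apply exp_pos.
    assert (0 < / c) by now apply Rinv_0_lt_compat.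
    unfold Rdiv; nra.
Qed.

(** As [F_pq p q] increases and is bounded on [[0, 1)], its improper value at 1 is
    its supremum there; hence it does not jump at 1. *)
Lemma F_pq_1_is_lub p q : 1 < p -> 1 < q ->
  (forall x, 0 <= x < 1 -> F_pq p q x <= F_pq p q 1) /\
  (forall c, c < F_pq p q 1 -> exists x, 0 <= x < 1 /\ c < F_pq p q x).
Proof.
  intros Hp Hq.
  destruct (completeness (fun z => exists x, 0 <= x < 1 /\ z = F_pq p q x)) as [L [HL1 HL2]].
  - exists (/ (1 - 1 / p)); intros z [x [Hx ->]]; now apply F_pq_bounded.
  - exists (F_pq p q 0), 0; split; [lra|easy].
  - assert (Hub : forall x, 0 <= x < 1 -> F_pq p q x <= L)
      by (intros x Hx; apply HL1; now exists x).
    assert (Hap : forall c, c < L -> exists x, 0 <= x < 1 /\ c < F_pq p q x).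
    { intros c Hc; destruct (Classical_Prop.classic (exists x, 0 <= x < 1 /\ c < F_pq p q x))
        as [H|H]; [exact H|exfalso].
      apply (Rlt_not_le _ _ Hc), HL2; intros z [x [Hx ->]].
      destruct (Rle_dec (F_pq p q x) c) as [H'|H']; [exact H'|].
      exfalso; apply H; exists x; lra. }
    assert (E : F_pq p q 1 = L).
    { unfold F_pq; destruct (Rlt_dec 1 1); [lra|].
      apply (is_RInt_gen_unique (V := R_CompleteNormedModule)).
      intros Q [eps HQ].
      destruct (Hap (L - eps)) as [x0 [Hx0 Hlt]]; [pose proof (cond_pos eps); lra|].
      exists (fun a => a = 0) (fun b => x0 < b < 1).
      - reflexivity.
      - assert (Hd : 0 < 1 - x0) by lra.
        exists (mkposreal _ Hd); intros y Hy Hy1.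
        unfold ball in Hy; simpl in Hy; unfold AbsRing_ball, abs, minus, plus, opp in Hy;
          simpl in Hy; apply Rabs_lt_between in Hy; lra.
      - intros a b -> Hb; simpl.
        exists (F_pq p q b); split.
        + rewrite F_pq_lt_1 by lra.
          apply (RInt_correct (V := R_CompleteNormedModule)), ex_RInt_F_integrand; lra.
        + apply HQ; unfold ball; simpl; unfold AbsRing_ball, abs, minus, plus, opp; simpl.
          pose proof (Hub b ltac:(lra)).
          pose proof (F_pq_expanding_lt_1 p q x0 b Hp Hq ltac:(lra) ltac:(lra)).
          apply Rabs_lt_between; lra. }
    rewrite E; now split.
Qed.

(** The integrand is at least 1.  This one inequality yields the injectivity of
    [F_pq], the positivity of [pi_pq] and a Lipschitz bound for the inverse, which
    replaces a separate study of the inverse near the singular endpoint. *)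
Lemma F_pq_expanding p q x y : 1 < p -> 1 < q -> 0 <= x -> x <= y -> y <= 1 ->
  y - x <= F_pq p q y - F_pq p q x.
Proof.
  intros Hp Hq Hx Hxy [Hy | ->]; [now apply F_pq_expanding_lt_1|].
  destruct Hxy as [Hx1 | ->]; [|lra].
  apply Rnot_lt_le; intros H.
  (* If the claim failed, [z < 1], and a point between [z] and 1 would contradict it. *)
  set (z := F_pq p q 1 - F_pq p q x + x) in *.
  set (y := Rmax x ((z + 1) / 2)).
  assert (Hy : x <= y < 1)
    by (unfold y; split; [apply Rmax_l|apply Rmax_lub_lt; unfold z; lra]).
  assert (z < y) by (pose proof (Rmax_r x ((z + 1) / 2)); fold y in H0; unfold z in *; lra).
  pose proof (F_pq_expanding_lt_1 p q x y Hp Hq ltac:(lra) ltac:(lra)).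
  pose proof (proj1 (F_pq_1_is_lub p q Hp Hq) y ltac:(lra)).
  unfold z in *; lra.
Qed.

Lemma pi_pq_pos p q : 1 < p -> 1 < q -> 0 < pi_pq p q.
Proof.
  intros Hp Hq; unfold pi_pq.
  pose proof (F_pq_expanding p q 0 1 Hp Hq ltac:(lra) ltac:(lra) ltac:(lra)) as H.
  rewrite F_pq_0 in H; lra.
Qed.

Lemma F_pq_surjective p q c : 1 < p -> 1 < q -> 0 <= c <= pi_pq p q / 2 ->
  exists x, 0 <= x <= 1 /\ F_pq p q x = c.
Proof.
  intros Hp Hq Hc; replace (pi_pq p q / 2) with (F_pq p q 1) in Hc
    by (unfold pi_pq; field).
  destruct (Req_dec c 0) as [->|Hc0]; [exists 0; split; [lra|apply F_pq_0]|].
  destruct (proj2 Hc) as [Hc1 | ->].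
  - destruct (proj2 (F_pq_1_is_lub p q Hp Hq) c Hc1) as [x0 [Hx0 Hlt]].
    assert (x0 <> 0) by (intros ->; rewrite F_pq_0 in Hlt; lra).
    destruct (f_interv_is_interv (F_pq p q) 0 x0 c) as [x [Hx E]].
    + lra.
    + rewrite F_pq_0; lra.
    + intros t Ht; apply derivable_continuous_pt, ex_derive_Reals_0.
      eexists; apply is_derive_F_pq; lra.
    + exists x; split; [lra|easy].
  - exists 1; split; [lra|easy].
Qed.

Lemma F_pq_inv_spec p q c : 1 < p -> 1 < q -> 0 <= c <= pi_pq p q / 2 ->
  0 <= F_pq_inv p q c <= 1 /\ F_pq p q (F_pq_inv p q c) = c.
Proof.
  intros Hp Hq Hc; unfold F_pq_inv.
  apply (iota_correct (V := R_CompleteNormedModule)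
           (fun x => 0 <= x <= 1 /\ F_pq p q x = c)).
  destruct (F_pq_surjective p q c Hp Hq Hc) as [x [Hx E]].
  exists x; split; [easy|]; intros y [Hy E'].
  destruct (Rle_dec x y).
  - pose proof (F_pq_expanding p q x y Hp Hq); lra.
  - pose proof (F_pq_expanding p q y x Hp Hq); lra.
Qed.

Lemma F_pq_inv_lipschitz p q a b : 1 < p -> 1 < q ->
  0 <= a <= pi_pq p q / 2 -> 0 <= b <= pi_pq p q / 2 ->
  Rabs (F_pq_inv p q a - F_pq_inv p q b) <= Rabs (a - b).
Proof.
  intros Hp Hq Ha Hb.
  destruct (F_pq_inv_spec p q a Hp Hq Ha) as [Ra Ea].
  destruct (F_pq_inv_spec p q b Hp Hq Hb) as [Rb Eb].
  set (x := F_pq_inv p q a) in *; set (y := F_pq_inv p q b) in *.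
  rewrite <- Ea, <- Eb.
  destruct (Rle_dec x y).
  - pose proof (F_pq_expanding p q x y Hp Hq).
    rewrite !(Rabs_minus_sym _ (_ y)), (Rabs_minus_sym x), !Rabs_pos_eq; lra.
  - pose proof (F_pq_expanding p q y x Hp Hq).
    rewrite !Rabs_pos_eq; lra.
Qed.

Lemma F_pq_inv_0 p q : 1 < p -> 1 < q -> F_pq_inv p q 0 = 0.
Proof.
  intros Hp Hq; pose proof (pi_pq_pos p q Hp Hq).
  destruct (F_pq_inv_spec p q 0 Hp Hq ltac:(lra)) as [Hr E].
  pose proof (F_pq_expanding p q 0 _ Hp Hq (Rle_refl 0) (proj1 Hr) (proj2 Hr)) as H1.
  rewrite E, F_pq_0 in H1; lra.
Qed.

Lemma sin_pq_half_period_reflect p q x :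
  sin_pq_half_period p q (pi_pq p q - x) = sin_pq_half_period p q x.
Proof.
  unfold sin_pq_half_period.
  destruct (Rle_dec (pi_pq p q - x) (pi_pq p q / 2)), (Rle_dec x (pi_pq p q / 2)).
  - f_equal; lra.
  - easy.
  - f_equal; lra.
  - lra.
Qed.

Lemma sin_pq_half_period_range p q x : 1 < p -> 1 < q -> 0 <= x <= pi_pq p q ->
  0 <= sin_pq_half_period p q x <= 1.
Proof.
  intros Hp Hq Hx; unfold sin_pq_half_period.
  destruct (Rle_dec x (pi_pq p q / 2)); apply F_pq_inv_spec; lra.
Qed.

Lemma sin_pq_half_period_0 p q : 1 < p -> 1 < q -> sin_pq_half_period p q 0 = 0.
Proof.
  intros Hp Hq; pose proof (pi_pq_pos p q Hp Hq); unfold sin_pq_half_period.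
  destruct (Rle_dec 0 (pi_pq p q / 2)); [now apply F_pq_inv_0|lra].
Qed.

(** When the two points lie on both sides of the middle of [[0, pi_pq p q]], reflecting
    one of them only brings them closer. *)
Lemma sin_pq_half_period_lipschitz p q a b : 1 < p -> 1 < q ->
  0 <= a <= pi_pq p q -> 0 <= b <= pi_pq p q ->
  Rabs (sin_pq_half_period p q a - sin_pq_half_period p q b) <= Rabs (a - b).
Proof.
  intros Hp Hq Ha Hb; unfold sin_pq_half_period.
  destruct (Rle_dec a (pi_pq p q / 2)), (Rle_dec b (pi_pq p q / 2));
    (eapply Rle_trans; [apply F_pq_inv_lipschitz; lra|]);
    unfold Rabs; repeat destruct Rcase_abs; lra.
Qed.

Lemma sin_pq_translate p q k r : 1 < p -> 1 < q -> - pi_pq p q <= r < pi_pq p q ->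
  sin_pq p q (r + IZR k * (2 * pi_pq p q)) =
  if Rle_dec 0 r then sin_pq_half_period p q r else - sin_pq_half_period p q (- r).
Proof.
  intros Hp Hq Hr; pose proof (pi_pq_pos p q Hp Hq).
  unfold sin_pq, reduce_pq.
  replace ((r + IZR k * (2 * pi_pq p q) + pi_pq p q) / (2 * pi_pq p q))
    with (IZR k + (r + pi_pq p q) / (2 * pi_pq p q)) by (field; lra).
  assert (0 <= (r + pi_pq p q) / (2 * pi_pq p q) < 1).
  { split; [apply Rmult_le_pos; [lra|left; apply Rinv_0_lt_compat; lra]|].
    apply (Rmult_lt_reg_r (2 * pi_pq p q)); [lra|].
    unfold Rdiv; rewrite Rmult_assoc, Rinv_l; lra. }
  rewrite <- (Int_part_spec _ k) by lra.
  replace (r + IZR k * (2 * pi_pq p q) - IZR k * (2 * pi_pq p q)) with r by ring.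
  reflexivity.
Qed.

Lemma pi_pq_reduce p q x : 1 < p -> 1 < q ->
  exists k r, - pi_pq p q <= r < pi_pq p q /\ x = r + IZR k * (2 * pi_pq p q).
Proof.
  intros Hp Hq; pose proof (pi_pq_pos p q Hp Hq).
  set (k := Int_part ((x + pi_pq p q) / (2 * pi_pq p q))).
  exists k, (x - IZR k * (2 * pi_pq p q)); split; [|ring].
  destruct (base_Int_part ((x + pi_pq p q) / (2 * pi_pq p q))) as [H1 H2]; fold k in H1, H2.
  assert (E : (x + pi_pq p q) / (2 * pi_pq p q) * (2 * pi_pq p q) = x + pi_pq p q)
    by (field; lra).
  split; nra.
Qed.

Lemma sin_pq_antiperiod p q x : 1 < p -> 1 < q ->
  sin_pq p q (x + pi_pq p q) = - sin_pq p q x.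
Proof.
  intros Hp Hq; pose proof (pi_pq_pos p q Hp Hq).
  destruct (pi_pq_reduce p q x Hp Hq) as [k [r [Hr ->]]].
  rewrite (sin_pq_translate p q k r) by assumption.
  destruct (Rle_dec 0 r) as [H0|H0].
  - replace (r + IZR k * (2 * pi_pq p q) + pi_pq p q)
      with (r - pi_pq p q + IZR (k + 1) * (2 * pi_pq p q)) by (rewrite plus_IZR; ring).
    rewrite sin_pq_translate by lra.
    destruct (Rle_dec 0 (r - pi_pq p q)); [lra|].
    replace (- (r - pi_pq p q)) with (pi_pq p q - r) by ring.
    now rewrite sin_pq_half_period_reflect.
  - replace (r + IZR k * (2 * pi_pq p q) + pi_pq p q)
      with (r + pi_pq p q + IZR k * (2 * pi_pq p q)) by ring.
    rewrite sin_pq_translate by lra.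
    destruct (Rle_dec 0 (r + pi_pq p q)); [|lra].
    rewrite Ropp_involutive, <- sin_pq_half_period_reflect; f_equal; ring.
Qed.

Lemma sin_pq_base p q x : 1 < p -> 1 < q -> - pi_pq p q < x < pi_pq p q ->
  sin_pq p q x =
  if Rle_dec 0 x then sin_pq_half_period p q x else - sin_pq_half_period p q (- x).
Proof.
  intros Hp Hq Hx; rewrite <- (sin_pq_translate p q 0) by lra; f_equal; ring.
Qed.

Lemma sin_pq_half_period_eq p q x : 1 < p -> 1 < q -> 0 <= x <= pi_pq p q ->
  sin_pq p q x = sin_pq_half_period p q x.
Proof.
  intros Hp Hq Hx; pose proof (pi_pq_pos p q Hp Hq).
  destruct (proj2 Hx) as [H1 | ->].
  - rewrite sin_pq_base by lra; destruct (Rle_dec 0 x); [easy|lra].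
  - rewrite <- (Rplus_0_l (pi_pq p q)) at 1; rewrite sin_pq_antiperiod, sin_pq_base by lra.
    destruct (Rle_dec 0 0); [|lra].
    rewrite <- (Rminus_0_r (pi_pq p q)), sin_pq_half_period_reflect.
    rewrite sin_pq_half_period_0 by assumption; ring.
Qed.

Lemma sin_pq_lipschitz p q x y : 1 < p -> 1 < q ->
  - pi_pq p q < x < pi_pq p q -> - pi_pq p q < y < pi_pq p q ->
  Rabs (sin_pq p q x - sin_pq p q y) <= Rabs (x - y).
Proof.
  intros Hp Hq Hx Hy; rewrite !sin_pq_base by assumption.
  assert (H0 := sin_pq_half_period_0 p q Hp Hq).
  assert (Hb : forall t, 0 <= t < pi_pq p q -> 0 <= sin_pq_half_period p q t <= t).
  { intros t Ht; split; [apply sin_pq_half_period_range; lra|].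
    pose proof (sin_pq_half_period_lipschitz p q t 0 Hp Hq ltac:(lra) ltac:(lra)) as H.
    rewrite H0, !Rminus_0_r, (Rabs_pos_eq t) in H by lra.
    pose proof (Rle_abs (sin_pq_half_period p q t)); lra. }
  destruct (Rle_dec 0 x), (Rle_dec 0 y).
  - apply sin_pq_half_period_lipschitz; lra.
  - specialize (Hb x ltac:(lra)) as Hbx; specialize (Hb (- y) ltac:(lra)) as Hby.
    rewrite !Rabs_pos_eq; lra.
  - specialize (Hb (- x) ltac:(lra)) as Hbx; specialize (Hb y ltac:(lra)) as Hby.
    rewrite !Rabs_left1; lra.
  - rewrite <- (Rabs_Ropp (x - y)).
    replace (- (x - y)) with (- x - - y) by ring.
    replace (- sin_pq_half_period p q (- x) - - sin_pq_half_period p q (- y))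
      with (- (sin_pq_half_period p q (- x) - sin_pq_half_period p q (- y))) by ring.
    rewrite Rabs_Ropp; apply sin_pq_half_period_lipschitz; lra.
Qed.

Lemma continuous_sin_pq_base p q x : 1 < p -> 1 < q ->
  - pi_pq p q < x < pi_pq p q -> continuous (sin_pq p q) x.
Proof.
  intros Hp Hq Hx Q [eps HQ].
  assert (Hd : 0 < Rmin eps (Rmin (pi_pq p q - x) (x + pi_pq p q)))
    by (repeat apply Rmin_pos; try lra; apply cond_pos).
  exists (mkposreal _ Hd); intros y Hy; apply HQ.
  unfold ball in *; simpl in *; unfold AbsRing_ball, abs, minus, plus, opp in *; simpl in *.
  assert (Hy1 := Rlt_le_trans _ _ _ Hy (Rmin_l _ _)).
  assert (Hy2 := Rlt_le_trans _ _ _ Hy (Rmin_r _ _)).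
  assert (Hy3 := Rlt_le_trans _ _ _ Hy2 (Rmin_l _ _)).
  assert (Hy4 := Rlt_le_trans _ _ _ Hy2 (Rmin_r _ _)).
  apply Rabs_lt_between in Hy3; apply Rabs_lt_between in Hy4.
  eapply Rle_lt_trans; [apply sin_pq_lipschitz; lra|exact Hy1].
Qed.

Lemma continuous_sin_pq p q x : 1 < p -> 1 < q -> continuous (sin_pq p q) x.
Proof.
  intros Hp Hq; pose proof (pi_pq_pos p q Hp Hq).
  assert (Hper : forall k y, sin_pq p q (y - IZR k * (2 * pi_pq p q)) = sin_pq p q y).
  { intros k y; destruct (pi_pq_reduce p q y Hp Hq) as [n [r [Hr ->]]].
    replace (r + IZR n * (2 * pi_pq p q) - IZR k * (2 * pi_pq p q))
      with (r + IZR (n - k) * (2 * pi_pq p q)) by (rewrite minus_IZR; ring).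
    now rewrite !sin_pq_translate. }
  assert (Hsh : forall c, continuous (fun y => y + c) x).
  { intros c; apply (continuous_plus (V := R_NormedModule));
      [apply continuous_id|apply continuous_const]. }
  destruct (pi_pq_reduce p q x Hp Hq) as [k [r [Hr E]]].
  (* The left end of the fundamental period is moved to 0 by one half period. *)
  destruct (Req_dec r (- pi_pq p q)) as [Er|Er].
  - apply continuous_ext with
      (fun y => opp (sin_pq p q (y + (pi_pq p q - IZR k * (2 * pi_pq p q))))).
    { intros y; unfold opp; simpl.
      replace (y + _) with (y + pi_pq p q - IZR k * (2 * pi_pq p q)) by ring.
      rewrite Hper, sin_pq_antiperiod by assumption; ring. }
    apply (continuous_opp (V := R_NormedModule)).
    apply (continuous_comp (fun y => y + _) (sin_pq p q)); [apply Hsh|].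
    apply continuous_sin_pq_base; lra.
  - apply continuous_ext with (fun y => sin_pq p q (y + - (IZR k * (2 * pi_pq p q)))).
    { intros y; apply Hper. }
    apply (continuous_comp (fun y => y + _) (sin_pq p q)); [apply Hsh|].
    apply continuous_sin_pq_base; lra.
Qed.

(** With [y] the value at [x], one has [F_pq p q y = x] and [y <= x], so the derivative 1
    of [F_pq] at 0 controls [y / x] uniformly for small [x]. *)
Lemma derivable_pt_lim_sin_pq_0 p q : 1 < p -> 1 < q ->
  derivable_pt_lim (sin_pq p q) 0 1.
Proof.
  intros Hp Hq eps Heps; pose proof (pi_pq_pos p q Hp Hq) as HP.
  assert (HF := is_derive_F_pq p q 0 Hq ltac:(lra)).
  rewrite F_integrand_0 in HF; apply is_derive_Reals in HF.
  destruct (HF eps Heps) as [delta Hdelta].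
  assert (Hpos : forall x, 0 < x < Rmin delta (pi_pq p q / 2) ->
            Rabs (sin_pq_half_period p q x / x - 1) < eps).
  { intros x Hx.
    pose proof (Rmin_l delta (pi_pq p q / 2)); pose proof (Rmin_r delta (pi_pq p q / 2)).
    unfold sin_pq_half_period; destruct (Rle_dec x (pi_pq p q / 2)); [|lra].
    destruct (F_pq_inv_spec p q x Hp Hq ltac:(lra)) as [Hr E].
    set (y := F_pq_inv p q x) in *.
    assert (Hy0 : y <> 0) by (intros Ey; rewrite Ey, F_pq_0 in E; lra).
    pose proof (F_pq_expanding p q 0 y Hp Hq ltac:(lra) ltac:(lra) ltac:(lra)) as Hyx.
    rewrite E, F_pq_0 in Hyx.
    specialize (Hdelta y Hy0).
    rewrite Rplus_0_l, E, F_pq_0, Rminus_0_r in Hdelta.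
    rewrite (Rabs_pos_eq y) in Hdelta by lra.
    specialize (Hdelta ltac:(lra)); apply Rabs_lt_between in Hdelta.
    assert (E1 : x / y * y = x) by (field; lra).
    assert (E2 : y / x * x = y) by (field; lra).
    assert (x - y < eps * y) by nra.
    apply Rabs_lt_between; split; apply (Rmult_lt_reg_r x); nra. }
  assert (Hd : 0 < Rmin delta (pi_pq p q / 2))
    by (apply Rmin_pos; [apply cond_pos|lra]).
  exists (mkposreal _ Hd); simpl; intros x Hx0 Hx.
  pose proof (Rmin_r delta (pi_pq p q / 2)).
  assert (H2 := Hx); apply Rabs_lt_between in H2.
  rewrite Rplus_0_l, (sin_pq_base p q 0), sin_pq_base by lra.
  destruct (Rle_dec 0 0); [|lra].
  rewrite sin_pq_half_period_0, Rminus_0_r by assumption.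
  destruct (Rle_dec 0 x).
  - apply Hpos; lra.
  - replace (- sin_pq_half_period p q (- x) / x)
      with (sin_pq_half_period p q (- x) / (- x)) by (field; lra).
    apply Hpos; lra.
Qed.

Lemma sine_like_sin_pq p q : 1 < p -> 1 < q -> sine_like (pi_pq p q) (sin_pq p q).
Proof.
  intros Hp Hq; pose proof (pi_pq_pos p q Hp Hq); split.
  - assumption.
  - intros x; now apply sin_pq_antiperiod.
  - intros x Hx; rewrite !sin_pq_half_period_eq by lra.
    apply sin_pq_half_period_reflect.
  - intros x Hx; rewrite sin_pq_half_period_eq by lra.
    now apply sin_pq_half_period_range.
  - apply continuous_over_id.
    + rewrite sin_pq_half_period_eq by lra; now apply sin_pq_half_period_0.
    + now apply derivable_pt_lim_sin_pq_0.
    + intros x; now apply continuous_sin_pq.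
Qed.

Theorem theorem1p1 :
  (forall p q : R, 1 < p -> 1 < q ->
    (ex_RInt (fun x => sin_pq p q (pi_pq p q * x) / sin (PI * x)) 0 1 /\
     is_RInt_0_infty (over_id (sin_pq p q))
       (PI / 2 *
        RInt (fun x => sin_pq p q (pi_pq p q * x) / sin (PI * x)) 0 1)) /\
    (ex_RInt (fun x => (sin_pq p q (pi_pq p q * x) / sin (PI * x)) ^ 2) 0 1 /\
     is_RInt_0_infty (fun x => over_id (sin_pq p q) x ^ 2)
       (PI ^ 2 / (2 * pi_pq p q) *
        RInt (fun x => (sin_pq p q (pi_pq p q * x) / sin (PI * x)) ^ 2) 0 1)))
  /\
  (is_RInt_0_infty (over_id sin) (PI / 2) /\
   is_RInt_0_infty (fun x => over_id sin x ^ 2) (PI / 2)).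
Proof.
  split; [|exact sin_integrals].
  intros p q Hp Hq; now apply sine_like_integrals, sine_like_sin_pq.
Qed.
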